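(* There is a universal constant $C>0$ such that the following holds for every $\epsilon\in(0,1)$. Let $G=(V,E)$ be a regular graph (as in the context) with a bisection $(S,V\setminus S)$, $|S|=\rho n$ with $\rho\le1/2$, and suppose the subgraphs induced on $S$ and on $V\setminus S$ both have expansion at least $\frac{C}{\epsilon^{1.5}}\Phi(S)\sqrt{\log n\log\frac{1}{\rho\epsilon}}$. Then, with $r=O(1/\rho)$, solving the $(r+3)$-round Lasserre relaxation of uniform sparsest cut and applying the Guruswami–Sinop rounding algorithm gives a $(1+\epsilon)$-approximation to sparsest cut.
   Context: $G=(V,E)$ is an undirected graph on $n$ vertices with capacities $C_{uv}\ge0$, regular with normalized degree 1. With $E(A,B)=\sum_{i\in A,j\in B}C_{ij}$: expansion $\Phi(S)=\frac{E(S,V\setminus S)}{\min(|S|,n-|S|)}$ (expansion within an induced subgraph is defined analogously using only edges and vertices of that subgraph), sparsity $\phi(S)=\frac{nE(S,V\setminus S)}{|S|(n-|S|)}$, $\phi_{sparsest}=\min_S\phi(S)$; a $(1+\epsilon)$-approximation is a set of sparsity at most $(1+\epsilon)\phi_{sparsest}$. Lasserre relaxation ($t$ rounds): vectors $x_S(f)$ for $S\subseteq V$, $|S|\le t+1$, $f\in\{0,1\}^S$, with $\|x_\emptyset\|^2=1$, $\langle x_S(f),x_T(g)\rangle=0$ when $f,g$ disagree on $S\cap T$, $\langle x_S(f),x_T(g)\rangle=\langle x_A(f'),x_B(g')\rangle$ whenever $S\cup T=A\cup B$ and $f\circ g=f'\circ g'$, and $\|x_{\{u\}}(0)\|^2+\|x_{\{u\}}(1)\|^2=1$;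 $x_u:=x_{\{u\}}(1)$; minimize $\frac{1}{n\mu(1-\mu)}\sum_{u<v}C_{uv}\|x_u-x_v\|^2$ over $\mu\in\{1/n,\dots,1/2\}$ and such vectors with $\frac1n\sum_ux_u=\mu x_\emptyset$. Guruswami–Sinop rounding: set $X_u=x_u-\frac1n\sum_vx_v$; choose a set $T$ of $r$ vertices by column selection on $[X_u]_u$ so as to make $\sum_u\|X_T^\perp X_u\|^2$ small ($X_T^\perp$ = projection onto the orthogonal complement of $\mathrm{span}\{X_u:u\in T\}$); sample $f\in\{0,1\}^T$ with probability $\|x_T(f)\|^2$; then threshold-round the values $\langle x_T(f),x_u\rangle/\|x_T(f)\|^2$. *)

(* Defs.v *)
From HB Require Import structures.
From mathcomp Require Import all_boot all_order all_algebra.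
From mathcomp Require Import boolp classical_sets reals exp.

Set Implicit Arguments.
Unset Strict Implicit.
Unset Printing Implicit Defensive.

Import Order.TTheory GRing.Theory Num.Theory.
Local Open Scope ring_scope.

Section Graphs.
Variables (R : realType) (n : nat).
Implicit Types (C : 'I_n -> 'I_n -> R) (S W A B : {set 'I_n}).

(* The graph is given by its capacities: [u] and [v] are adjacent iff
   [0 < C u v].  Nothing is required of the diagonal; self-loops count towards
   the degree and never cross a cut. *)
Definition regular_graph C : Prop :=
  [/\ forall u v, 0 <= C u v,
      forall u v, C u v = C v u &
      forall u, \sum_(v < n) C u v = 1].

Definition edge_weight C A B : R := \sum_(i in A) \sum_(j in B) C i j.

(* The expansion of [A] inside the subgraph induced on [W], for [A \subset W]. *)
Definition induced_expansion C W A : R :=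
  edge_weight C A (W :\: A) / (minn #|A| (#|W| - #|A|))%:R.

Definition expansion C S : R := induced_expansion C [set: 'I_n] S.

Definition induced_expansion_ge C W (beta : R) : Prop :=
  forall A, A != finset.set0 -> A \proper W -> beta <= induced_expansion C W A.

Definition sparsity C S : R :=
  n%:R * edge_weight C S (~: S) / (#|S|%:R * (n - #|S|)%:R).

Definition is_cut S : Prop := S != finset.set0 /\ S != [set: 'I_n].

(* A minimum whenever [1 < n], since there are finitely many cuts. *)
Definition sparsest C : R := inf (image is_cut (sparsity C)).

Definition approx_sparsest C (eps : R) A : Prop :=
  is_cut A /\ sparsity C A <= (1 + eps) * sparsest C.

End Graphs.

Section Vectors.
Variables (R : realType) (m : nat).
Implicit Types (u v : 'rV[R]_m).

Definition dot u v : R := \sum_(i < m) u 0 i * v 0 i.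

Definition sqnorm u : R := dot u u.

(* The orthogonal projection (acting on row vectors from the right) onto the
   orthogonal complement of the row space of [W]: the rows [v] with
   [v *m W^T = 0], along the row space itself. *)
Definition perp_proj (W : 'M[R]_m) : 'M[R]_m := proj_mx (kermx W^T) W.

End Vectors.

Section Lasserre.
Variables (R : realType) (n : nat).

(* An assignment [f : S -> {0, 1}] is represented by the set
   [F = f^-1 (1) \subset S], so [x S F] is the vector [x_S(f)]; only the values
   at [F \subset S] with [S] small enough are meaningful.  Assignments [f] on
   [S] and [g] on [T] agree on [S :&: T] iff [F :&: T = G :&: S], and then
   their union is represented by [F :|: G]. *)
Definition vector_family (m : nat) := {set 'I_n} -> {set 'I_n} -> 'rV[R]_m.

Variables (t m : nat).
Implicit Types (x : vector_family m) (S T A B F G : {set 'I_n}).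

Definition local_assignment S F : bool := (#|S| <= t.+1)%N && (F \subset S).

Definition agree S F T G : bool := F :&: T == G :&: S.

Definition lasserre_vectors x : Prop :=
  [/\ sqnorm (x finset.set0 finset.set0) = 1,
      forall S F T G, local_assignment S F -> local_assignment T G ->
        ~~ agree S F T G -> dot (x S F) (x T G) = 0,
      forall S F T G A F' B G',
        local_assignment S F -> local_assignment T G ->
        local_assignment A F' -> local_assignment B G' ->
        agree S F T G -> agree A F' B G' ->
        S :|: T = A :|: B -> F :|: G = F' :|: G' ->
        dot (x S F) (x T G) = dot (x A F') (x B G') &
      forall u : 'I_n,
        sqnorm (x [set u] finset.set0) + sqnorm (x [set u] [set u]) = 1].

Definition vertex_vector x (u : 'I_n) : 'rV[R]_m := x [set u] [set u].

(* [k] encodes [mu = k / n], which ranges over 1/n, 2/n, ..., up to 1/2. *)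
Definition lasserre_feasible (k : nat) x : Prop :=
  [/\ (0 < k)%N, (k.*2 <= n)%N, lasserre_vectors x &
      n%:R^-1 *: \sum_(u < n) vertex_vector x u
        = (k%:R / n%:R) *: x finset.set0 finset.set0].

Definition lasserre_objective (C : 'I_n -> 'I_n -> R) (k : nat) x : R :=
  let mu := k%:R / n%:R in
  (n%:R * mu * (1 - mu))^-1 *
  \sum_(u < n) \sum_(v < n | (u < v)%N)
     C u v * sqnorm (vertex_vector x u - vertex_vector x v).

End Lasserre.

(* Optimal among all values of mu and vectors in spaces of any dimension. *)
Definition lasserre_optimal (R : realType) (n t : nat)
    (C : 'I_n -> 'I_n -> R) (m k : nat) (x : vector_family R n m) : Prop :=
  lasserre_feasible t k x /\
  forall (m' k' : nat) (x' : vector_family R n m'), lasserre_feasible t k' x' ->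
    lasserre_objective C k x <= lasserre_objective C k' x'.

Section Rounding.
Variables (R : realType) (n m : nat) (x : vector_family R n m).
Implicit Types (T F A : {set 'I_n}).

Definition centered_vector (u : 'I_n) : 'rV[R]_m :=
  vertex_vector x u - n%:R^-1 *: \sum_(v < n) vertex_vector x v.

Definition projection_error (W : 'M[R]_m) : R :=
  \sum_(u < n) sqnorm (centered_vector u *m perp_proj W).

Definition seed_span T : 'M[R]_m := (\sum_(u in T) <<centered_vector u>>)%MS.

(* What column selection provides is the Guruswami--Sinop bound: the error of
   the columns [T] is at most (r + 1) / (r + 1 - k) times the error of any
   subspace of dimension k <= r, that is, times the sum of all but the k largest
   eigenvalues of the Gram matrix.  Volume sampling meets it in expectation,
   so it is met by its derandomization and by the best [r]-set.  All the
   vertices are taken when there are fewer than [r]. *)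
Definition column_selection (r : nat) T : Prop :=
  #|T| = minn r n /\
  forall W : 'M[R]_m, (\rank W <= #|T|)%N ->
    (#|T|.+1 - \rank W)%:R * projection_error (seed_span T)
      <= #|T|.+1%:R * projection_error W.

Definition rounding_value T F (u : 'I_n) : R :=
  dot (x T F) (vertex_vector x u) / sqnorm (x T F).

Definition threshold_set T F (tau : R) : {set 'I_n} :=
  [set u | tau <= rounding_value T F u].

(* The best threshold is used, so that a sample [F] succeeds iff one of its
   threshold sets is a (1 + eps)-approximation. *)
Definition rounding_succeeds (C : 'I_n -> 'I_n -> R) (eps : R) T F : Prop :=
  exists tau : R, approx_sparsest C eps (threshold_set T F tau).

(* The sample [F] of an assignment on [T] has probability [sqnorm (x T F)]. *)
Definition success_probability (C : 'I_n -> 'I_n -> R) (eps : R) T : R :=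
  \sum_(F in powerset T | `[< rounding_succeeds C eps T F >]) sqnorm (x T F).

End Rounding.

(* Main.v *)
(* One seed vertex is enough (r = 1).  By the Lasserre constraints the vertex
   vectors satisfy the triangle inequality for d(u, v) = |x_u - x_v|^2, so the
   Arora--Rao--Vazirani inequality applies to each side W of the planted cut:
   the average of d over W is O(sqrt (log n)) times its Lasserre cost over the
   expansion of W.  Hence the centered vectors are concentrated around two
   collinear points, up to an error of eps / 12 of their total variance; column
   selection picks a seed with at most twice this error, and the loss of
   Guruswami--Sinop rounding is this error divided by eps, by Markov's
   inequality applied to the excess over sparsest cut, which is nonnegative for
   every sample.

   The Arora--Rao--Vazirani inequality is proved without chaining.  For random
   signs s let g_u = <s, x_u> and h_u = max_v (g_v - lam d(u, v)), which is
   lam-Lipschitz for d, so that expansion makes it nearly constant on average.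
   The maximizer is at distance O(log n / lam^2), so h_u - g_u has variance
   O(log n / lam^2) and is close to its mean m_u.  Thus g_u - g_v is close to
   m_v - m_u, and replacing s by - s, so is its opposite: the g_u are close to
   each other on average, and therefore so are the x_u. *)

Require Import Defs.
From mathcomp Require Import all_boot all_order all_algebra.
From mathcomp Require Import boolp classical_sets reals exp.
From mathcomp Require Import finset zify ring lra.
Import Order.TTheory GRing.Theory Num.Theory.
Local Open Scope ring_scope.

Set Implicit Arguments.
Unset Strict Implicit.
Unset Printing Implicit Defensive.

Local Notation expR := sequences.expR.

(** * Random signs *)

Section DotProduct.
Variables (R : realType) (m : nat).
Implicit Types (u v w : 'rV[R]_m).

Lemma dotE u v : dot u v = (u *m v^T) 0 0.
Proof. by rewrite mxE; apply: eq_bigr => i _; rewrite mxE. Qed.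

Lemma dotC u v : dot u v = dot v u.
Proof. by apply: eq_bigr => i _; rewrite mulrC. Qed.

Lemma dotDl u v w : dot (u + v) w = dot u w + dot v w.
Proof. by rewrite !dotE mulmxDl mxE. Qed.

Lemma dotZl a u v : dot (a *: u) v = a * dot u v.
Proof. by rewrite !dotE -scalemxAl mxE. Qed.

Lemma dotNl u v : dot (- u) v = - dot u v.
Proof. by rewrite -scaleN1r dotZl mulN1r. Qed.

Lemma dotBl u v w : dot (u - v) w = dot u w - dot v w.
Proof. by rewrite dotDl dotNl. Qed.

Lemma dotDr u v w : dot w (u + v) = dot w u + dot w v.
Proof. by rewrite dotC dotDl !(dotC w). Qed.

Lemma dotZr a u v : dot u (a *: v) = a * dot u v.
Proof. by rewrite dotC dotZl dotC. Qed.

Lemma dotNr u v : dot u (- v) = - dot u v.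
Proof. by rewrite dotC dotNl dotC. Qed.

Lemma dotBr u v w : dot w (u - v) = dot w u - dot w v.
Proof. by rewrite dotDr dotNr. Qed.

Lemma dot0l u : dot 0 u = 0.
Proof. by rewrite -(scale0r u) dotZl mul0r. Qed.

Lemma dot0r u : dot u 0 = 0.
Proof. by rewrite dotC dot0l. Qed.

Lemma dot_suml (I : Type) (r : seq I) (P : pred I) (F : I -> 'rV[R]_m) v :
  dot (\sum_(i <- r | P i) F i) v = \sum_(i <- r | P i) dot (F i) v.
Proof.
by elim/big_rec2: _ => [|i a b _ IH]; rewrite ?dot0l // dotDl IH.
Qed.

Lemma dot_sumr (I : Type) (r : seq I) (P : pred I) (F : I -> 'rV[R]_m) v :
  dot v (\sum_(i <- r | P i) F i) = \sum_(i <- r | P i) dot v (F i).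
Proof. by rewrite dotC dot_suml; apply: eq_bigr => i _; rewrite dotC. Qed.

Lemma sqnorm_ge0 u : 0 <= sqnorm u.
Proof. by apply: sumr_ge0 => i _; rewrite -expr2 sqr_ge0. Qed.

Lemma sqnorm_eq0 u : sqnorm u = 0 -> u = 0.
Proof.
move=> /eqP; rewrite psumr_eq0 => [|i _]; last by rewrite -expr2 sqr_ge0.
move=> /allP u0; apply/rowP => i; rewrite mxE; apply/eqP.
by have := u0 i (mem_index_enum i); rewrite /= -expr2 sqrf_eq0.
Qed.

Lemma sqnormZ a u : sqnorm (a *: u) = a ^+ 2 * sqnorm u.
Proof. by rewrite /sqnorm dotZl dotZr mulrA expr2. Qed.

Lemma sqnormN u : sqnorm (- u) = sqnorm u.
Proof. by rewrite /sqnorm dotNl dotNr opprK. Qed.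

Lemma sqnorm0 : sqnorm (0 : 'rV[R]_m) = 0.
Proof. by rewrite /sqnorm dot0l. Qed.

Lemma sqnormD u v : sqnorm (u + v) = sqnorm u + 2 * dot u v + sqnorm v.
Proof. by rewrite /sqnorm dotDl !dotDr (dotC v u); lra. Qed.

Lemma sqnormB u v : sqnorm (u - v) = sqnorm u - 2 * dot u v + sqnorm v.
Proof. by rewrite sqnormD sqnormN dotNr; lra. Qed.

Lemma sqnormBC u v : sqnorm (u - v) = sqnorm (v - u).
Proof. by rewrite -sqnormN opprB. Qed.

End DotProduct.

Section SignMean.
Variable R : realType.

(* The average over the sign vectors in {-1, 1}^m. *)
Fixpoint sign_mean (m : nat) : ('rV[R]_m -> R) -> R :=
  match m with
  | 0 => fun f => f 0
  | k.+1 => fun f =>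
      (sign_mean (fun s : 'rV_k => f (row_mx (1%:M : 'rV_1) s)) +
       sign_mean (fun s : 'rV_k => f (row_mx ((-1)%:M : 'rV_1) s))) / 2
  end.

Lemma eq_sign_mean m (f g : 'rV[R]_m -> R) :
  (forall s, f s = g s) -> sign_mean f = sign_mean g.
Proof. by move=> fg; congr sign_mean; apply/funext. Qed.

Lemma ler_sign_mean m (f g : 'rV[R]_m -> R) :
  (forall s, f s <= g s) -> sign_mean f <= sign_mean g.
Proof.
elim: m f g => [|k IH] f g fg /=; first exact: fg.
by rewrite ler_pM2r ?invr_gt0 ?ltr0n// lerD// IH.
Qed.

Lemma sign_mean_cst m (a : R) : sign_mean (fun _ : 'rV[R]_m => a) = a.
Proof. by elim: m => [//|k IH] /=; rewrite IH; lra. Qed.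

Lemma sign_meanD m (f g : 'rV[R]_m -> R) :
  sign_mean (fun s => f s + g s) = sign_mean f + sign_mean g.
Proof. by elim: m f g => [//|k IH] f g /=; rewrite !IH; lra. Qed.

Lemma sign_meanZ m (a : R) (f : 'rV[R]_m -> R) :
  sign_mean (fun s => a * f s) = a * sign_mean f.
Proof. by elim: m f => [//|k IH] f /=; rewrite !IH; lra. Qed.

Lemma sign_meanB m (f g : 'rV[R]_m -> R) :
  sign_mean (fun s => f s - g s) = sign_mean f - sign_mean g.
Proof.
rewrite -[in RHS]mulN1r -sign_meanZ -sign_meanD.
by apply: eq_sign_mean => s; rewrite mulN1r.
Qed.

Lemma sign_mean_sum m (I : Type) (r : seq I) (P : pred I)
    (F : I -> 'rV[R]_m -> R) :
  sign_mean (fun s => \sum_(i <- r | P i) F i s) =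
  \sum_(i <- r | P i) sign_mean (F i).
Proof.
elim: r => [|i r IH].
  rewrite big_nil -[RHS](sign_mean_cst m).
  by apply: eq_sign_mean => s; rewrite big_nil.
rewrite big_cons -IH; case: ifP => Pi; last first.
  by apply: eq_sign_mean => s; rewrite big_cons Pi.
by rewrite -sign_meanD; apply: eq_sign_mean => s; rewrite big_cons Pi.
Qed.

Lemma sign_mean_opp m (f : 'rV[R]_m -> R) :
  sign_mean (fun s => f (- s)) = sign_mean f.
Proof.
elim: m f => [|k IH] f /=; first by rewrite oppr0.
rewrite -(IH (fun s => f (row_mx 1%:M s))) addrC.
rewrite -(IH (fun s => f (row_mx (-1)%:M s))).
have scalN (a : R) (s : 'rV_k) :
    - row_mx (a%:M : 'rV_1) s = row_mx (- a)%:M (- s) :> 'rV_k.+1.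
  by rewrite (opp_row_mx (a%:M : 'rV_1) s) raddfN.
congr ((_ + _) / _); apply: eq_sign_mean => s; rewrite scalN ?opprK //.
Qed.

Lemma dot_consl k (a : R) (s : 'rV_k) (v : 'rV[R]_(1 + k)) :
  dot (row_mx (a%:M : 'rV_1) s) v = a * lsubmx v 0 0 + dot s (rsubmx v).
Proof.
rewrite /dot big_split_ord big_ord1 /=; congr (_ + _).
  by rewrite row_mxEl !mxE eqxx mulr1n.
by apply: eq_bigr => i _; rewrite row_mxEr !mxE.
Qed.

Lemma sqnorm_split k (v : 'rV[R]_(1 + k)) :
  sqnorm v = lsubmx v 0 0 ^+ 2 + sqnorm (rsubmx v).
Proof.
rewrite /sqnorm /dot big_split_ord big_ord1 /=; congr (_ + _).
  by rewrite !mxE expr2.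
by apply: eq_bigr => i _; rewrite !mxE.
Qed.

Lemma expR_ge_inv (x : R) : x < 1 -> expR x <= (1 - x)^-1.
Proof.
move=> x1; rewrite -[x]opprK expRN lef_pV2 ?posrE ?expR_gt0 ?opprK ?subr_gt0//.
exact: expR_ge1Dx.
Qed.

(** Squaring e^(x/2) <= 1 / (1 - x/2) makes the left side rational, and the right side is at least 2
    (1 + x^2). In y = x^2 / 4 <= 1/16 this leaves y (1 - 7 y + 4 y^2) >= 0. *)
Lemma expR_pair_le_small (x : R) :
  `|x| <= 1 / 2 -> expR x + expR (- x) <= 2 * expR (x ^+ 2).
Proof.
rewrite ler_norml => /andP[xl xu].
have hx : expR x <= (1 - x / 2)^-1 ^+ 2.
  rewrite {1}[x](_ : x = 2%:R * (x / 2)); last by lra.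
  by rewrite expRM_natl lerXn2r ?nnegrE ?expR_ge0 ?invr_ge0 ?expR_ge_inv; lra.
have hNx : expR (- x) <= (1 + x / 2)^-1 ^+ 2.
  rewrite [- x](_ : - x = 2%:R * (- (x / 2))); last by lra.
  rewrite expRM_natl lerXn2r ?nnegrE ?expR_ge0 ?invr_ge0 //; first by lra.
  by rewrite -{2}[x / 2]opprK expR_ge_inv; lra.
apply: le_trans (lerD hx hNx) _.
apply: le_trans (_ : _ <= 2 * (1 + x ^+ 2)) _; last first.
  by rewrite ler_pM2l ?expR_ge1Dx.
have -> : (1 - x / 2)^-1 ^+ 2 + (1 + x / 2)^-1 ^+ 2 =
    2 * (1 + x ^+ 2 / 4) / (1 - x ^+ 2 / 4) ^+ 2.
  by field; apply/and3P; split; rewrite gt_eqF //; nra.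
rewrite ler_pdivrMr; last by apply: exprn_gt0; nra.
set y := x ^+ 2 / 4.
have [y0 y1] : 0 <= y /\ y <= 1 / 16 by split; rewrite /y; nra.
have -> : x ^+ 2 = 4 * y by rewrite /y; lra.
have q0 : 0 <= 1 - 7 * y + 4 * y ^+ 2 by nra.
have := mulr_ge0 y0 q0; nra.
Qed.

Lemma expR_pair_le (x : R) : expR x + expR (- x) <= 2 * expR (x ^+ 2).
Proof.
have [x1|x1] := leP `|x| 1; last first.
  have x2 : `|x| <= x ^+ 2 by rewrite -(real_normK (num_real x)); nra.
  rewrite mulr_natl mulr2n; apply: lerD; rewrite ler_expR.
    exact: le_trans (ler_norm _) x2.
  by apply: le_trans (ler_norm _) _; rewrite normrN.
(* The inequality for y gives the one for 2 y, as cosh (2 y) <= (cosh y) ^ 4. *)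
have [y xE] : exists y, x = 2%:R * y by exists (x / 2); lra.
have : expR y + expR (- y) <= 2 * expR (y ^+ 2).
  apply: expR_pair_le_small; move: x1.
  by rewrite xE normrM [`|2%:R|]ger0_norm //; lra.
have -> : expR x = expR y ^+ 2 by rewrite xE expRM_natl.
have -> : expR (- x) = (expR y)^-1 ^+ 2 by rewrite xE -mulrN expRM_natl expRN.
have -> : expR (x ^+ 2) = expR (y ^+ 2) ^+ 4.
  by rewrite -expRM_natl xE; congr expR; ring.
rewrite expRN.
have p0 := expR_gt0 y; set p := expR y in p0 *.
have q0 := expR_gt0 (y ^+ 2); set q := expR _ in q0 *.
have pp : p * p^-1 = 1 by rewrite divff// gt_eqF.
have r0 : 0 < p^-1 by rewrite invr_gt0.
set r := p^-1 in pp r0 * => le_pq.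
set c := (p + r) / 2.
have -> : p ^+ 2 + r ^+ 2 = 2 * (2 * c ^+ 2 - 1).
  by rewrite /c; have : p ^+ 2 + r ^+ 2 = (p + r) ^+ 2 - 2 * (p * r); [ring|move=> ->; rewrite pp; field].
rewrite ler_pM2l//.
have c0 : 0 <= c by rewrite /c; lra.
have cq : c <= q by rewrite /c; lra.
have : c ^+ 4 <= q ^+ 4 by rewrite lerXn2r ?nnegrE // ltW.
apply: le_trans; have := sqr_ge0 (c ^+ 2 - 1); rewrite [(_ - 1) ^+ 2](_ : _ = c ^+ 4 - 2 * c ^+ 2 + 1); [lra|ring].
Qed.

(** The signs are independent, so the mean factors over the coordinates a of v, and each factor is
    cosh a <= exp (a^2). *)
Lemma sign_mean_expR m (v : 'rV[R]_m) :
  sign_mean (fun s => expR (dot s v)) <= expR (sqnorm v).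
Proof.
elim: m v => [|k IH] v /=; first by rewrite dot0l ler_expR sqnorm_ge0.
set a := lsubmx (v : 'rV_(1 + k)) 0 0.
have cons_mean b : sign_mean (fun s : 'rV_k => expR (dot (row_mx (b%:M : 'rV_1) s) v)) =
    expR (b * a) * sign_mean (fun s => expR (dot s (rsubmx (v : 'rV_(1 + k))))).
  by rewrite -sign_meanZ; apply: eq_sign_mean => s; rewrite dot_consl expRD.
rewrite !cons_mean -mulrDl mul1r mulN1r (sqnorm_split (v : 'rV_(1 + k))) expRD.
rewrite mulrAC ler_pM ?divr_ge0 ?addr_ge0 ?expR_ge0 //.
  by rewrite -[0](sign_mean_cst k); apply: ler_sign_mean => s; rewrite expR_ge0.
by rewrite ler_pdivrMr// mulrC expR_pair_le.
Qed.

Lemma sign_mean_dot2 m (v : 'rV[R]_m) :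
  sign_mean (fun s => dot s v ^+ 2) = sqnorm v.
Proof.
elim: m v => [|k IH] v /=; first by rewrite dot0l expr0n /sqnorm /dot big_ord0.
rewrite -sign_meanD (sqnorm_split (v : 'rV_(1 + k))).
set a := lsubmx _ _ _; set w := rsubmx (v : 'rV_(1 + k)).
rewrite (_ : sign_mean _ = 2 * (a ^+ 2 + sqnorm w)); first by field.
rewrite -IH -[a ^+ 2](sign_mean_cst k) -sign_meanD -sign_meanZ.
by apply: eq_sign_mean => s; rewrite !dot_consl -/a -/w; ring.
Qed.

(** Averaging over the first sign kills the odd powers of the coordinate a and leaves a^4 + 6 a^2
    |w|^2 + E <s, w>^4, whose last term is at most 3 |w|^4 by induction. *)
Lemma sign_mean_dot4 m (v : 'rV[R]_m) :
  sign_mean (fun s => dot s v ^+ 4) <= 3 * sqnorm v ^+ 2.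
Proof.
elim: m v => [|k IH] v /=.
  by rewrite dot0l expr0n /= mulr_ge0 // sqr_ge0.
rewrite -sign_meanD (sqnorm_split (v : 'rV_(1 + k))).
set a := lsubmx _ _ _; set w := rsubmx (v : 'rV_(1 + k)).
rewrite (_ : sign_mean _ = 2 * (sign_mean (fun s => dot s w ^+ 4) +
    6 * a ^+ 2 * sqnorm w + a ^+ 4)); last first.
  rewrite -sign_mean_dot2 -sign_meanZ -sign_meanD -[a ^+ 4](sign_mean_cst k).
  rewrite -sign_meanD -sign_meanZ.
  by apply: eq_sign_mean => s; rewrite !dot_consl -/a -/w; ring.
have := IH w; have := sqr_ge0 (a ^+ 2); nra.
Qed.

(* Khintchine's inequality; the polynomial t - 3 t^2 / 4 + t^4 / 12 is
   nonnegative for t >= 0. *)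
Lemma sign_mean_norm_dot m (v : 'rV[R]_m) :
  Num.sqrt (sqnorm v) <= 2 * sign_mean (fun s => `|dot s v|).
Proof.
have [v0|v0] := eqVneq (sqnorm v) 0.
  rewrite v0 sqrtr0 mulr_ge0 // -[0](sign_mean_cst m).
  exact: ler_sign_mean.
have sq := sqr_sqrtr (sqnorm_ge0 v).
have : 0 < Num.sqrt (sqnorm v) by rewrite sqrtr_gt0 lt_def v0 sqnorm_ge0.
set q := Num.sqrt _ in sq *; move=> q0.
have le1 : sign_mean (fun s => (3 / 4 / q) * dot s v ^+ 2 -
    (1 / 12 / q ^+ 3) * dot s v ^+ 4) <= sign_mean (fun s => `|dot s v|).
  apply: ler_sign_mean => s.
  have -> : dot s v ^+ 4 = `|dot s v| ^+ 4.
    by rewrite -normrX ger0_norm// (exprM _ 2 2) sqr_ge0.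
  rewrite -[dot s v ^+ 2]real_normK ?num_real//.
  set z := `|dot s v|; have z0 : 0 <= z by rewrite normr_ge0.
  have [t t0 zE] : exists2 t, 0 <= t & z = t * q.
    by exists (z / q); rewrite ?divr_ge0 ?divfK ?gt_eqF // ltW.
  rewrite zE (_ : _ - _ = (3 / 4 * t ^+ 2 - 1 / 12 * t ^+ 4) * q); last first.
    by field; rewrite gt_eqF.
  rewrite ler_pM2r//.
  (* The polynomial t - 3 t^2 / 4 + t^4 / 12 exceeds a twelfth of this product by nonnegative
     multiples of t and t^2. The double root 7/4 is a rational point close to sqrt 3, where 1 - 3 t
     / 4 + t^3 / 12 is least. *)
  have : 0 <= t * ((t - 7 / 4) ^+ 2 * (t + 7 / 2)).
    by apply: mulr_ge0 => //; apply: mulr_ge0; [exact: sqr_ge0|lra].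
  rewrite [t * _](_ : _ = t ^+ 4 - 147 / 16 * t ^+ 2 + 343 / 32 * t); last by field.
  have := sqr_ge0 t; lra.
(* The second and fourth moments bound the left side below by (3/4 - 3/12) q = q / 2. *)
rewrite sign_meanB !sign_meanZ sign_mean_dot2 -sq in le1.
have m4 := sign_mean_dot4 v; rewrite -sq in m4.
have : 1 / 12 / q ^+ 3 * sign_mean (fun s => dot s v ^+ 4) <= q / 4.
  rewrite [q / 4](_ : _ = 1 / 12 / q ^+ 3 * (3 * (q ^+ 2) ^+ 2)); last first.
    by field; rewrite gt_eqF.
  by apply: ler_wpM2l m4; rewrite !divr_ge0 ?exprn_ge0 // ltW.
have sqE : 3 / 4 / q * q ^+ 2 = 3 / 4 * q by field; rewrite gt_eqF.
rewrite sqE in le1; lra.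
Qed.

Lemma sqr_sign_mean_le m (f : 'rV[R]_m -> R) :
  sign_mean f ^+ 2 <= sign_mean (fun s => f s ^+ 2).
Proof.
have : 0 <= sign_mean (fun s => (f s - sign_mean f) ^+ 2).
  by rewrite -[0](sign_mean_cst m); apply: ler_sign_mean => s; rewrite sqr_ge0.
set M := sign_mean f.
rewrite (_ : sign_mean _ = sign_mean (fun s => f s ^+ 2) - M ^+ 2) ?subr_ge0//.
rewrite (eq_sign_mean (g := fun s => f s ^+ 2 + ((- 2 * M) * f s + M ^+ 2))).
  by rewrite !sign_meanD sign_meanZ sign_mean_cst -/M; ring.
by move=> s; ring.
Qed.

(* The Poincare (Efron--Stein) inequality of the cube for a function [f] with a
   subgradient [p], as is the case of a maximum of affine functions. *)
Lemma sign_mean_variance m (f : 'rV[R]_m -> R) (p : 'rV[R]_m -> 'rV[R]_m) :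
  (forall s s', f s + dot (s' - s) (p s) <= f s') ->
  sign_mean (fun s => f s ^+ 2) - sign_mean f ^+ 2
    <= 2 * sign_mean (fun s => sqnorm (p s)).
Proof.
elim: m f p => [|k IH] f p sub_p /=.
  by rewrite subrr mulr_ge0 // sqnorm_ge0.
pose cons (b : R) (s : 'rV[R]_k) : 'rV[R]_k.+1 := row_mx (b%:M : 'rV_1) s.
pose fb (b : R) (s : 'rV[R]_k) := f (cons b s).
pose tl (b : R) (s : 'rV[R]_k) : 'rV[R]_k := rsubmx (p (cons b s) : 'rV_(1 + k)).
pose hd (b : R) (s : 'rV[R]_k) := lsubmx (p (cons b s) : 'rV_(1 + k)) 0 0.
have consB b c s s' : cons c s' - cons b s = cons (c - b) (s' - s).
  by rewrite /cons (opp_row_mx (b%:M : 'rV_1) s) (add_row_mx (c%:M : 'rV_1)) -raddfB.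
have IHb b : sign_mean (fun s => fb b s ^+ 2) - sign_mean (fb b) ^+ 2
    <= 2 * sign_mean (fun s => sqnorm (tl b s)).
  apply: IH => s s'; have := sub_p (cons b s) (cons b s').
  by rewrite consB dot_consl subrr mul0r add0r.
(* The variance is the average of the two conditional variances plus a quarter of the squared gap
   between the conditional means. *)
have gap : (sign_mean (fb 1) - sign_mean (fb (-1))) ^+ 2 <=
    4 * (sign_mean (fun s => hd 1 s ^+ 2) + sign_mean (fun s => hd (-1) s ^+ 2)).
  rewrite -sign_meanB -sign_meanD -sign_meanZ.
  apply: le_trans (sqr_sign_mean_le _) _; apply: ler_sign_mean => s.
  (* The subgradients at the two ends confine f (1, s) - f (-1, s) to the interval from 2
     [hd (-1) s] to 2 [hd 1 s]. *)
  have := sub_p (cons 1 s) (cons (-1) s).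
  have := sub_p (cons (-1) s) (cons 1 s).
  rewrite !consB subrr !dot_consl !dot0l -/(hd 1 s) -/(hd (-1) s) -/(fb 1 s) -/(fb (-1) s).
  move=> h1 h2.
  have [d0|d0] := leP 0 (fb 1 s - fb (-1) s).
    have : (fb 1 s - fb (-1) s) ^+ 2 <= (2 * hd 1 s) ^+ 2.
      by rewrite lerXn2r ?nnegrE; lra.
    have := sqr_ge0 (hd (-1) s); nra.
  have : (fb (-1) s - fb 1 s) ^+ 2 <= (- 2 * hd (-1) s) ^+ 2.
    by rewrite lerXn2r ?nnegrE; lra.
  have := sqr_ge0 (hd 1 s); nra.
have normE b : sign_mean (fun s => sqnorm (p (cons b s))) =
    sign_mean (fun s => hd b s ^+ 2) + sign_mean (fun s => sqnorm (tl b s)).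
  by rewrite -sign_meanD; apply: eq_sign_mean => s; rewrite -sqnorm_split.
have := IHb 1; have := IHb (-1); move: gap.
rewrite (normE 1) (normE (-1)) /fb.
nra.
Qed.

End SignMean.

(** * Regularized projections *)

Section RegularizedMaximum.
Variables (R : realType) (I : finType) (W : {set I}) (m : nat).
Variables (x : I -> 'rV[R]_m) (lam L : R).
Hypotheses (lam_gt0 : 0 < lam) (L_gt0 : 0 < L) (card_W : #|W|%:R <= expR L).
Hypothesis triangle : forall u v z, u \in W -> v \in W -> z \in W ->
  sqnorm (x u - x v) <= sqnorm (x u - x z) + sqnorm (x z - x v).

Let penalized (s : 'rV[R]_m) (u v : I) : R :=
  dot s (x v) - lam * sqnorm (x u - x v).

Let best (s : 'rV[R]_m) (u : I) : I := [arg max_(v > u in W) penalized s u v]%O.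

(* The least [lam]-Lipschitz majorant on [W] of the projection
   [u |-> dot s (x u)]. *)
Definition reg_max (s : 'rV[R]_m) (u : I) : R := penalized s u (best s u).

Let excess (u : I) (s : 'rV[R]_m) : R := reg_max s u - dot s (x u).

Let bestP s u : u \in W ->
  best s u \in W /\ forall v, v \in W -> penalized s u v <= reg_max s u.
Proof. by move=> uW; rewrite /reg_max /best; case: arg_maxP. Qed.

(** The maximizer for one vertex competes for the other, and by the triangle inequality its penalty
    grows by at most lam d(u, v). *)
Lemma reg_max_lipschitz s u v : u \in W -> v \in W ->
  `|reg_max s u - reg_max s v| <= lam * sqnorm (x u - x v).
Proof.
have oneside a b : a \in W -> b \in W ->
    reg_max s a - reg_max s b <= lam * sqnorm (x a - x b).
  move=> aW bW; have [caW _] := bestP s aW; have [_ maxb] := bestP s bW.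
  have := maxb _ caW; rewrite {2}/reg_max /penalized.
  have := triangle bW caW aW; rewrite (sqnormBC (x b) (x a)).
  by move=> /(ler_wpM2l (ltW lam_gt0)); rewrite mulrDr; lra.
move=> uW vW; rewrite ler_norml lerNl opprB oneside//.
by rewrite sqnormBC oneside.
Qed.

(** With the maximizer frozen the excess is affine in the signs, with gradient x (best s u) - x u:
    this is the subgradient to feed to the variance inequality. *)
Let excess_sub u : u \in W -> forall s s',
  excess u s + dot (s' - s) (x (best s u) - x u) <= excess u s'.
Proof.
move=> uW s s'; have [cW _] := bestP s uW; have [_ maxs'] := bestP s' uW.
have := maxs' _ cW; rewrite /excess {2}/reg_max /penalized dotBl !dotBr; lra.
Qed.

(* By optimality <s, z> >= lam |z|^2 for z = x (best s u) - x u, so some term of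
   the union bound over [W] at parameter lam / 2 is at least
   exp (lam^2 |z|^2 / 4). *)
Let best_close u : u \in W ->
  sign_mean (fun s => sqnorm (x (best s u) - x u)) <= 4 * L / lam ^+ 2.
Proof.
(* The exponent obtained below is at least (th lam - th^2) |z|^2, which is largest at th = lam /
   2. *)
move=> uW; pose th := lam / 2.
pose z v := x v - x u.
pose total s := \sum_(v in W) expR (- sqnorm (th *: z v)) * expR (dot s (th *: z v)).
have mean_total : sign_mean total <= expR L.
  apply: le_trans card_W; rewrite sign_mean_sum -sum1_card natr_sum.
  apply: ler_sum => v _; rewrite sign_meanZ.
  apply: le_trans (ler_wpM2l (expR_ge0 _) (sign_mean_expR _)) _.
  by rewrite -expRD addNr expR0.
have ge_total s : expR (lam ^+ 2 / 4 * sqnorm (z (best s u))) <= total s.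
  have [cW maxs] := bestP s uW.
  rewrite /total (bigD1 (best s u))//=; apply: le_trans (_ : _ <= _ + 0) _; last first.
    by apply: lerD => //; apply: sumr_ge0 => v _; rewrite mulr_ge0 ?expR_ge0.
  rewrite addr0 -expRD ler_expR sqnormZ dotZr.
  have := maxs _ uW; rewrite /reg_max /penalized subrr sqnorm0 mulr0 subr0.
  rewrite (sqnormBC (x u)) -/(z _) {2}/z dotBr /th.
  move: (dot s (x (best s u))) (dot s (x u)) (sqnorm _) => a b c h.
  have -> : - ((lam / 2) ^+ 2 * c) + lam / 2 * (a - b) =
     lam ^+ 2 / 4 * c + lam / 2 * (a - lam * c - b) by field.
  by rewrite lerDl mulr_ge0 ?subr_ge0// divr_ge0// ltW.
(* After division by exp L, the bound exp y >= 1 + y turns the exponential moment into a second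
   moment. *)
have : sign_mean (fun s => 1 + (lam ^+ 2 / 4 * sqnorm (z (best s u)) - L)) <= 1.
  apply: le_trans (_ : sign_mean (fun s => expR (- L) * total s) <= _).
    apply: ler_sign_mean => s; apply: le_trans (expR_ge1Dx _) _.
    by rewrite addrC expRD ler_wpM2l ?expR_ge0.
  rewrite sign_meanZ; apply: le_trans (ler_wpM2l (expR_ge0 _) mean_total) _.
  by rewrite -expRD addNr expR0.
rewrite sign_meanD sign_meanB sign_meanZ !sign_mean_cst => h.
rewrite ler_pdivlMr ?exprn_gt0//; rewrite /z in h; lra.
Qed.

(** The variance inequality and [best_close] bound the variance by 8 L / lam^2; 3 is a rational
    bound for sqrt 8, with enough slack for the AM-GM step. *)
Let excess_concentrated u : u \in W ->
  sign_mean (fun s => `|excess u s - sign_mean (excess u)|) <=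
    3 * (Num.sqrt L / lam).
Proof.
move=> uW; set M := sign_mean (excess u).
have q0 : 0 < Num.sqrt L by rewrite sqrtr_gt0.
have [del delE del0] : exists2 del : R, del = 3 * (Num.sqrt L / lam) & 0 < del.
  by exists (3 * (Num.sqrt L / lam)) => //; rewrite mulr_gt0 ?divr_gt0.
rewrite -delE.
have var := sign_mean_variance (excess_sub uW); rewrite -/M in var.
have var8 : sign_mean (fun s => excess u s ^+ 2) - M ^+ 2 <= 8 / 9 * del ^+ 2.
  apply: le_trans var _; have h := best_close uW.
  rewrite -{1}(sqr_sqrtr (ltW L_gt0)) in h; rewrite delE.
  have -> : 8 / 9 * (3 * (Num.sqrt L / lam)) ^+ 2 =
     2 * (4 * Num.sqrt L ^+ 2 / lam ^+ 2) by field; rewrite gt_eqF.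
  by rewrite ler_pM2l.
(* AM-GM: |y| <= del / 2 + y^2 / (2 del) *)
apply: le_trans (_ : sign_mean (fun s => del / 2 + (1 / (2 * del)) *
    (excess u s ^+ 2 + ((- 2 * M) * excess u s + M ^+ 2))) <= _).
  apply: ler_sign_mean => s; set e := excess u s.
  have -> : del / 2 + 1 / (2 * del) * (e ^+ 2 + (- 2 * M * e + M ^+ 2)) =
    (del ^+ 2 + (e - M) ^+ 2) / (2 * del) by field; rewrite gt_eqF.
  rewrite ler_pdivlMr ?mulr_gt0// -(real_normK (num_real (e - M))).
  have := sqr_ge0 (del - `|e - M|); nra.
rewrite sign_meanD sign_mean_cst sign_meanZ !sign_meanD sign_meanZ sign_mean_cst -/M.
have -> : sign_mean (fun s => excess u s ^+ 2) + (- 2 * M * M + M ^+ 2) =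
   sign_mean (fun s => excess u s ^+ 2) - M ^+ 2 by ring.
apply: le_trans (_ : _ <= del / 2 + 1 / (2 * del) * (8 / 9 * del ^+ 2)) _.
  by rewrite lerD2l ler_wpM2l// divr_ge0// mulr_ge0// ltW.
have -> : 1 / (2 * del) * (8 / 9 * del ^+ 2) = 4 / 9 * del.
  by field; rewrite gt_eqF.
lra.
Qed.

(* At [s] and at [- s], [dot s (x u - x v)] differs from [m v - m u] only by the
   gap of [reg_max] and by the deviations of the excesses from their means
   [m]: hence it is small itself. *)
Lemma sqrt_sqnorm_le_reg_max u v : u \in W -> v \in W ->
  Num.sqrt (sqnorm (x u - x v)) <=
    2 * sign_mean (fun s => `|reg_max s u - reg_max s v|)
    + 12 * (Num.sqrt L / lam).
Proof.
move=> uW vW; apply: le_trans (sign_mean_norm_dot _) _.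
pose dev a s := `|excess a s - sign_mean (excess a)|.
pose M := sign_mean (excess u) - sign_mean (excess v).
pose G s := `|reg_max s u - reg_max s v| + (dev u s + dev v s).
have GE s : `|dot s (x u - x v) + M| <= G s.
  rewrite /G /dev /M /excess dotBr.
  set hu := reg_max s u; set hv := reg_max s v.
  set mu := sign_mean _; set mv := sign_mean _.
  have -> : dot s (x u) - dot s (x v) + (mu - mv) =
    (hu - hv) + (- (hu - dot s (x u) - mu) + (hv - dot s (x v) - mv)) by ring.
  apply: le_trans (ler_normD _ _) _; rewrite lerD2l.
  by apply: le_trans (ler_normD _ _) _; rewrite normrN.
have GNE s : `|dot s (x u - x v) - M| <= G (- s).
  by rewrite distrC addrC -dotNl; apply: GE.
have : sign_mean (fun s => 2 * `|dot s (x u - x v)|) <= 2 * sign_mean G.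
  have -> : 2 * sign_mean G = sign_mean G + sign_mean (fun s => G (- s)).
    by rewrite sign_mean_opp; ring.
  rewrite -sign_meanD.
  apply: ler_sign_mean => s; apply: le_trans (lerD (GE s) (GNE s)).
  set t := dot _ _; have -> : 2 * `|t| = `|(t + M) + (t - M)|.
    by rewrite -{1}(ger0_norm (ler0n R 2)) -normrM; congr (`|_|); ring.
  exact: ler_normD.
rewrite sign_meanZ /G !sign_meanD => h; apply: le_trans h _.
have := excess_concentrated uW; have := excess_concentrated vW; rewrite /dev; lra.
Qed.

End RegularizedMaximum.

(** The cut hypothesis is applied to [reg_max s] for each s and averaged: along an edge this
    function varies by at most lam d(u, v). The last term pays for replacing projections by
    regularized ones. *)
Lemma sum_sqrt_sqnorm_le (R : realType) (I : finType) (W : {set I}) (m : nat)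
    (x : I -> 'rV[R]_m) (w : I -> I -> R) (b N lam L : R) :
  0 < lam -> 0 < L -> #|W|%:R <= expR L -> 0 <= b -> 0 <= N ->
  (forall u v, 0 <= w u v) ->
  (forall u v z, u \in W -> v \in W -> z \in W ->
     sqnorm (x u - x v) <= sqnorm (x u - x z) + sqnorm (x z - x v)) ->
  (forall f : I -> R,
     b * \sum_(u in W) \sum_(v in W) `|f u - f v|
       <= N * \sum_(u in W) \sum_(v in W) w u v * `|f u - f v|) ->
  b * \sum_(u in W) \sum_(v in W) Num.sqrt (sqnorm (x u - x v)) <=
    2 * lam * N * (\sum_(u in W) \sum_(v in W) w u v * sqnorm (x u - x v))
    + 12 * b * #|W|%:R ^+ 2 * (Num.sqrt L / lam).
Proof.
move=> lam0 L0 cardW b0 N0 w0 tri cut.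
set a := Num.sqrt L / lam; set Q := \sum_(u in W) \sum_(v in W) w u v * _.
pose gap u v := sign_mean (fun s => `|reg_max W x lam s u - reg_max W x lam s v|).
have le_gap : \sum_(u in W) \sum_(v in W) Num.sqrt (sqnorm (x u - x v)) <=
    2 * (\sum_(u in W) \sum_(v in W) gap u v) + 12 * #|W|%:R ^+ 2 * a.
  rewrite [12 * _ * a](_ : _ = \sum_(u in W) \sum_(v in W) 12 * a); last first.
    by rewrite !sumr_const -mulrnA -[RHS]mulr_natr natrM; ring.
  rewrite mulr_sumr -big_split; apply: ler_sum => u uW /=.
  rewrite mulr_sumr -big_split; apply: ler_sum => v vW /=.
  exact: sqrt_sqnorm_le_reg_max.
have gapE : \sum_(u in W) \sum_(v in W) gap u v = sign_mean (fun s =>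
    \sum_(u in W) \sum_(v in W) `|reg_max W x lam s u - reg_max W x lam s v|).
  by rewrite sign_mean_sum; apply: eq_bigr => u _; rewrite sign_mean_sum.
have : b * \sum_(u in W) \sum_(v in W) gap u v <= lam * N * Q.
  rewrite gapE -sign_meanZ -[X in _ <= X](sign_mean_cst m).
  apply: ler_sign_mean => s; apply: le_trans (cut _) _.
  rewrite [lam * N]mulrC -mulrA ler_wpM2l // mulr_sumr.
  apply: ler_sum => u uW; rewrite mulr_sumr.
  apply: ler_sum => v vW; rewrite mulrCA ler_wpM2l//.
  exact: reg_max_lipschitz.
move: (ler_wpM2l b0 le_gap); lra.
Qed.

(** * The Arora--Rao--Vazirani inequality *)

Section Coarea.
Variables (R : realType) (I : finType) (W : {set I}) (w : I -> I -> R).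

(** A discrete coarea formula, for weights of any sign. Raising the minimum of f on W to its second
    smallest value f b removes exactly f b - f a times the cut at level f b; the induction is on the
    number of points above the minimum. *)
Lemma coarea_pos (f : I -> R) :
  (forall tau, 0 <= \sum_(u in W | tau <= f u) \sum_(v in W | f v < tau) w u v) ->
  0 <= \sum_(u in W) \sum_(v in W) w u v * Num.max 0 (f u - f v).
Proof.
pose above g := [set u in W | [exists v in W, g v < g u :> R]].
have [k] := ubnP #|above f|; elim: k f => // k IH f lek cut.
have [/eqP a0|] := boolP (above f == set0).
  rewrite big1 // => u uW; rewrite big1 // => v vW.
  suff : f u <= f v by rewrite -subr_le0 => /max_l ->; rewrite mulr0.
  have : u \notin above f by rewrite a0 inE.
  by rewrite inE uW /= negb_exists => /forallP/(_ v); rewrite vW /= -leNgt.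
case/set0Pn => b0 b0in.
case: (@arg_minP _ _ _ b0 [in above f] f b0in) => b bin bmin.
have {}bin : b \in above f by [].
have {}bmin u : u \in above f -> f b <= f u by apply: bmin.
have bW : b \in W by move: bin; rewrite inE => /andP[].
case: (arg_minP f bW) => a aW amin; have {}aW : a \in W by [].
have ltab : f a < f b.
  move: bin; rewrite inE bW /= => /existsP[v /andP[vW]].
  by apply: le_lt_trans; apply: amin.
have two_values u : u \in W -> f u = f a \/ f b <= f u.
  move=> uW; have [/bmin ?|] := boolP (u \in above f); first by right.
  rewrite inE uW /= negb_exists => /forallP/(_ a); rewrite aW /= -leNgt => ua.
  by left; apply/le_anti; rewrite ua amin.
pose g u := Num.max (f u) (f b).
have gE u : g u = if f u < f b then f b else f u by [].
(* Up to level f b nothing lies below the threshold; beyond it f and g have the same level sets. *)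
have cutg tau : 0 <= \sum_(u in W | tau <= g u) \sum_(v in W | g v < tau) w u v.
  have [taub|btau] := leP tau (f b).
    rewrite big1 // => u _; rewrite big_pred0 // => v.
    by rewrite ltNge le_max taub orbT andbF.
  have := cut tau; congr (0 <= _); apply: eq_big => [u|u _].
    by rewrite le_max [tau <= f b]leNgt btau orbF.
  by apply: eq_bigl => v; rewrite gt_max btau andbT.
have ltk : (#|above g| < k)%N.
  apply: leq_trans (_ : #|above f| <= k)%N => //; apply/proper_card/properP.
  split; last first.
    exists b => //; rewrite inE bW /= negb_exists; apply/forallP => v.
    by rewrite negb_and -leNgt /g maxxx le_max lexx !orbT.
  apply/fintype.subsetP => u; rewrite !inE => /andP[uW /existsP[v /andP[vW]]].
  rewrite uW /= /g gt_max => /andP[]; rewrite lt_max => /orP[vu _|].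
    by apply/existsP; exists v; rewrite vW.
  move=> _; rewrite lt_max ltxx orbF => bu.
  by apply/existsP; exists b; rewrite bW.
have step u v : u \in W -> v \in W ->
    w u v * Num.max 0 (f u - f v) = w u v * Num.max 0 (g u - g v) +
    (f b - f a) * (if f b <= f u then if f v < f b then w u v else 0 else 0).
  move=> uW vW; rewrite !gE !maxEle !subr_ge0.
  have [->|bu] := two_values u uW; have [->|bv] := two_values v vW.
  - by rewrite lexx ltab lexx (lt_geF ltab); ring.
  - rewrite ltab (lt_geF ltab) [f v < _]ltNge bv (lt_geF (lt_le_trans ltab bv)) /=.
    case: ifP => h; last by ring.
    have -> : f b = f v by apply/le_anti; rewrite bv h.
    by ring.
  - rewrite ltab [f u < _]ltNge bu /= (le_trans (ltW ltab) bu) ?bu; ring.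
  - by rewrite [f u < _]ltNge bu [f v < _]ltNge bv /=; ring.
have -> : \sum_(u in W) \sum_(v in W) w u v * Num.max 0 (f u - f v) =
    \sum_(u in W) \sum_(v in W) w u v * Num.max 0 (g u - g v) +
    (f b - f a) * \sum_(u in W | f b <= f u) \sum_(v in W | f v < f b) w u v.
  rewrite big_mkcondr mulr_sumr -big_split /=; apply: eq_bigr => u uW.
  rewrite (eq_bigr _ (fun v vW => step u v uW vW)) big_split /=; congr (_ + _).
  rewrite -mulr_sumr; congr (_ * _); case: ifP => _; last by rewrite big1.
  by rewrite big_mkcondr.
by rewrite addr_ge0 ?IH // mulr_ge0 ?cut // subr_ge0 ltW.
Qed.

Lemma coarea (f : I -> R) :
  (forall u v, w u v = w v u) ->
  (forall tau, 0 <= \sum_(u in W | tau <= f u) \sum_(v in W | f v < tau) w u v) ->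
  0 <= \sum_(u in W) \sum_(v in W) w u v * `|f u - f v|.
Proof.
move=> wC /coarea_pos pos.
suff -> : \sum_(u in W) \sum_(v in W) w u v * `|f u - f v| =
    \sum_(u in W) \sum_(v in W) w u v * Num.max 0 (f u - f v) +
    \sum_(u in W) \sum_(v in W) w u v * Num.max 0 (f u - f v).
  exact: addr_ge0.
rewrite [X in _ = _ + X]exchange_big -big_split; apply: eq_bigr => u _ /=.
rewrite -big_split; apply: eq_bigr => v _ /=; rewrite (wC v u) -mulrDr.
congr (_ * _); have [uv|vu] := leP (f u) (f v).
  by rewrite ler0_norm ?subr_le0// max_l ?subr_le0// max_r ?subr_ge0//; lra.
by rewrite gtr0_norm ?subr_gt0// max_r ?subr_ge0 ?ltW// max_l ?subr_le0 ?ltW //; lra.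
Qed.

End Coarea.

Lemma half_le_sqrt (R : realType) (a : R) : 1 / 4 <= a -> 1 / 2 <= Num.sqrt a.
Proof.
move=> a4; have a0 : 0 <= a by lra.
have := sqr_sqrtr a0; have := sqrtr_ge0 a; nra.
Qed.

Section AverageDistance.
Variables (R : realType) (I : finType) (W : {set I}) (m : nat).
Variables (x : I -> 'rV[R]_m) (w : I -> I -> R) (b L : R).
Hypotheses (b_ge0 : 0 <= b) (L_ge : 1 / 4 <= L) (card_W : #|W|%:R <= expR L).
Hypotheses (w_ge0 : forall u v, 0 <= w u v) (wC : forall u v, w u v = w v u).
Hypothesis triangle : forall u v z, u \in W -> v \in W -> z \in W ->
  sqnorm (x u - x v) <= sqnorm (x u - x z) + sqnorm (x z - x v).
Hypothesis expanding : forall A : {set I}, A \subset W ->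
  b * (#|A|%:R * #|W :\: A|%:R)
    <= #|W|%:R * \sum_(u in A) \sum_(v in W :\: A) w u v.

Let d u v := sqnorm (x u - x v).

(** The two sides merge into the signed weight |W| w - b, whose cuts are nonnegative by expansion,
    so that coarea applies. *)
Lemma cut_metric_le (f : I -> R) :
  b * \sum_(u in W) \sum_(v in W) `|f u - f v|
    <= #|W|%:R * \sum_(u in W) \sum_(v in W) w u v * `|f u - f v|.
Proof.
rewrite -subr_ge0 !mulr_sumr -sumrB.
rewrite (eq_bigr (fun u =>
  \sum_(v in W) (#|W|%:R * w u v - b) * `|f u - f v|)); last first.
  by move=> u _; rewrite !mulr_sumr -sumrB; apply: eq_bigr => v _; ring.
apply: coarea => [u v|tau]; first by rewrite wC.
pose A := [set u in W | tau <= f u].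
have AE u : (u \in W) && (tau <= f u) = (u \in A) by rewrite inE.
have BE v : (v \in W) && (f v < tau) = (v \in W :\: A).
  by rewrite !inE andbC; case: (v \in W); rewrite ?andbF //= ltNge.
rewrite (eq_bigl _ _ AE).
rewrite (eq_bigr (fun u => #|W|%:R * (\sum_(v in W :\: A) w u v) - b * #|W :\: A|%:R)).
  rewrite sumrB -mulr_sumr sumr_const subr_ge0 -[X in X <= _]mulr_natl.
  rewrite mulrCA; apply: expanding.
  by apply/fintype.subsetP => u; rewrite inE => /andP[].
move=> u _; rewrite (eq_bigl _ _ BE) sumrB -mulr_sumr sumr_const.
by rewrite -[X in _ - X = _]mulr_natr.
Qed.

Let dC u v : d u v = d v u. Proof. exact: sqnormBC. Qed.

Let d_ge0 u v : 0 <= d u v. Proof. exact: sqnorm_ge0. Qed.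

Let N : R := #|W|%:R.
Let D := \sum_(u in W) \sum_(v in W) d u v.
Let Q := \sum_(u in W) \sum_(v in W) w u v * d u v.

(** The coordinate max (0, d(u, o) - rad) is 1-Lipschitz for d and vanishes on A. The distances to o
    sum to at least D / (2 N), of which subtracting rad removes D / (4 N); pairing the rest with the
    N / 4 points of A gives D / 16. *)
Let average_distance_of_ball o (A : {set I}) (rad : R) :
  o \in W -> A \subset W -> N / 4 <= #|A|%:R -> rad = D / N ^+ 2 / 4 ->
  (forall u, u \in A -> d u o <= rad) ->
  b * D <= 16 * N * Q.
Proof.
move=> oW AW cardA radE near.
have N0 : 0 < N by rewrite ltr0n (cardD1 o) oW.
pose f u := Num.max 0 (d u o - rad).
have f_ge0 u : 0 <= f u by rewrite le_max lexx.
have lip u v : u \in W -> v \in W -> `|f u - f v| <= d u v.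
  have oneside a c : a \in W -> c \in W -> f a - f c <= d a c.
    move=> aW cW; have := triangle aW oW cW; rewrite -!/(d _ _) => tri.
    rewrite lerBlDr ge_max addr_ge0//= /f.
    have : d c o - rad <= Num.max 0 (d c o - rad) by rewrite le_max lexx orbT.
    lra.
  move=> uW vW; rewrite ler_norml lerNl opprB oneside// andbT.
  by rewrite dC oneside.
have le_sum : #|A|%:R * \sum_(v in W) f v <= \sum_(u in W) \sum_(v in W) `|f u - f v|.
  rewrite [X in _ <= X](big_setID A) /= (setIidPr AW) mulr_natl -sumr_const.
  apply: le_trans (_ : _ <= _ + 0) _; last first.
    by apply: lerD; [exact: lexx|apply: sumr_ge0 => u _; exact: sumr_ge0].
  rewrite addr0; apply: ler_sum => u uA; apply: ler_sum => v _.
  have -> : f u = 0 by rewrite /f max_l// subr_le0 near.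
  by rewrite sub0r normrN ger0_norm.
have sumd : D <= 2 * N * \sum_(v in W) d v o.
  rewrite (_ : 2 * N * _ = \sum_(u in W) (d u o * N + \sum_(v in W) d v o)).
    apply: ler_sum => u uW; rewrite mulr_natr -sumr_const -big_split.
    by apply: ler_sum => v vW; rewrite /= (dC v); apply: triangle.
  by rewrite big_split /= -mulr_suml sumr_const -[X in _ = _ + X]mulr_natl; ring.
have sumf : \sum_(v in W) d v o - N * rad <= \sum_(v in W) f v.
  rewrite mulr_natl -sumr_const -sumrB; apply: ler_sum => v _.
  by rewrite le_max lexx orbT.
have NrE : N * rad = D / N / 4 by rewrite radE; field; rewrite gt_eqF.
have sumf' : D / N / 4 <= \sum_(v in W) f v.
  apply: le_trans sumf; rewrite NrE.
  have : D / N / 2 <= \sum_(v in W) d v o.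
    by rewrite !ler_pdivrMr //; lra.
  lra.
have D0 : 0 <= D by apply: sumr_ge0 => u _; apply: sumr_ge0 => v _.
have big : D / 16 <= \sum_(u in W) \sum_(v in W) `|f u - f v|.
  apply: le_trans le_sum; apply: le_trans (_ : N / 4 * (D / N / 4) <= _).
    by rewrite le_eqVlt; apply/orP; left; apply/eqP; field; rewrite gt_eqF.
  by apply: ler_pM => //; rewrite !divr_ge0 // ltW.
have := cut_metric_le f; rewrite -/N => cut.
have le_Q : \sum_(u in W) \sum_(v in W) w u v * `|f u - f v| <= Q.
  by apply: ler_sum => u uW; apply: ler_sum => v vW; rewrite ler_wpM2l ?lip.
have := ler_wpM2l b_ge0 big; have := ler_wpM2l (ltW N0) le_Q; lra.
Qed.

(* Uniform sparsest cut with the Arora--Rao--Vazirani factor: a heavy ball makes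
   the distance to its centre a good Frechet coordinate; otherwise the distances
   are spread, and random projections do. *)
Lemma average_distance_le :
  b * \sum_(u in W) \sum_(v in W) sqnorm (x u - x v) <=
    768 * Num.sqrt L * #|W|%:R *
    \sum_(u in W) \sum_(v in W) w u v * sqnorm (x u - x v).
Proof.
rewrite -/N -[X in b * X]/D -[X in _ <= _ * X]/Q.
have Q0 : 0 <= Q.
  by apply: sumr_ge0 => u _; apply: sumr_ge0 => v _; rewrite mulr_ge0.
have sL := half_le_sqrt L_ge.
have N_ge0 : 0 <= N by apply: ler0n.
have D_ge0 : 0 <= D by apply: sumr_ge0 => u _; apply: sumr_ge0 => v _.
have [D0|Dn0] := eqVneq D 0.
  by rewrite D0 mulr0 !mulr_ge0 // ?sqrtr_ge0.
have D_gt0 : 0 < D by rewrite lt_def Dn0.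
have N0 : 0 < N.
  rewrite lt_def N_ge0 andbT; apply: contraNneq Dn0 => /eqP.
  by rewrite pnatr_eq0 cards_eq0 /D => /eqP ->; rewrite big_set0.
pose rad := D / N ^+ 2 / 4.
have rad0 : 0 < rad by rewrite !divr_gt0// exprn_gt0.
pose ball o := [set u in W | d u o <= rad].
have [/existsP[o /andP[oW heavy]]|/existsPn light] :=
    boolP [exists o in W, N / 4 <= #|ball o|%:R].
  apply: le_trans (_ : 16 * N * Q <= _); last first.
    have := mulr_ge0 N_ge0 Q0 => NQ.
    have := ler_wpM2r NQ sL; lra.
  apply: (average_distance_of_ball oW _ heavy erefl).
    by apply/fintype.subsetP => u; rewrite inE => /andP[].
  by move=> u; rewrite inE => /andP[].
pose q := Num.sqrt (D / N ^+ 2).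
have q0 : 0 < q by rewrite sqrtr_gt0 divr_gt0 // exprn_gt0.
have q2 : N ^+ 2 * q ^+ 2 = D.
  rewrite sqr_sqrtr; last by rewrite divr_ge0 // exprn_ge0.
  by rewrite mulrC divfK // expf_neq0 // gt_eqF.
(* As rad = q^2 / 4, the points outside the ball are at root distance at least q / 2, and there are
   at least 3 N / 4 of them. *)
have far o : o \in W -> 3 / 8 * N * q <= \sum_(v in W) Num.sqrt (d o v).
  move=> oW; have := light o; rewrite oW /= -ltNge => lto.
  rewrite (big_setID (ball o)) /=; apply: le_trans (_ : _ <= 0 + _) _; last first.
    by apply: lerD; [apply: sumr_ge0 => v _; exact: sqrtr_ge0|exact: lexx].
  rewrite add0r; apply: le_trans (_ : _ <= \sum_(v in W :\: ball o) q / 2) _; last first.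
    apply: ler_sum => v; rewrite !inE negb_and andb_orl andNb /= -ltNge.
    move=> /andP[vo vW].
    rewrite dC /rad in vo.
    have q2' : q ^+ 2 = D / N ^+ 2.
      by rewrite sqr_sqrtr // divr_ge0 // exprn_ge0.
    by have := sqr_sqrtr (d_ge0 o v); have := sqrtr_ge0 (d o v); nra.
  rewrite sumr_const -[X in _ <= X]mulr_natl.
  have : N = #|ball o|%:R + #|W :\: ball o|%:R.
    rewrite -natrD /N -(cardsID (ball o) W) (setIidPr _) //.
    by apply/fintype.subsetP => u; rewrite inE => /andP[].
  by nra.
have L0 : 0 < L by apply: lt_le_trans L_ge; lra.
have s0 : 0 < Num.sqrt L by rewrite sqrtr_gt0.
(* With this lam the error term is b N^2 q / 8, a third of the lower bound 3 b N^2 q / 8 coming from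
   [far]. *)
have lam0 : 0 < 96 * Num.sqrt L / q by rewrite divr_gt0 // mulr_gt0.
have := sum_sqrt_sqnorm_le lam0 L0 card_W b_ge0 N_ge0 w_ge0 triangle cut_metric_le.
rewrite -/N -[X in _ * X + _]/Q.
have -> : Num.sqrt L / (96 * Num.sqrt L / q) = q / 96.
  by field; rewrite !gt_eqF.
move=> le1.
have le2 : b * (3 / 8 * N ^+ 2 * q) <=
    b * \sum_(u in W) \sum_(v in W) Num.sqrt (sqnorm (x u - x v)).
  apply: ler_wpM2l => //.
  rewrite (_ : 3 / 8 * N ^+ 2 * q = \sum_(u in W) (3 / 8 * N * q)).
    exact: ler_sum.
  by rewrite sumr_const -[RHS]mulr_natl; ring.
have : b * (N ^+ 2 * q / 4) <= 192 * (Num.sqrt L / q) * N * Q by lra.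
move=> /(ler_wpM2r (ltW q0)).
have -> : 192 * (Num.sqrt L / q) * N * Q * q = 192 * Num.sqrt L * N * Q.
  by field; rewrite gt_eqF.
rewrite -q2; lra.
Qed.

End AverageDistance.

(** * Projections and Lasserre vectors *)

Section PerpProj.
Variables (R : realType) (m : nat) (W : 'M[R]_m).
Implicit Types (u v z : 'rV[R]_m).

Lemma dot_kermx u v : (u <= kermx W^T)%MS -> (v <= W)%MS -> dot u v = 0.
Proof.
move=> /sub_kermxP uW /submxP[a ->].
by rewrite dotE trmx_mul mulmxA uW mul0mx mxE.
Qed.

(** A row in both spaces is orthogonal to itself, hence zero, so the ranks add up to m. This makes
    [perp_proj] a true orthogonal projection. *)
Lemma kermx_tr_add_full : row_full (kermx W^T + W)%MS.
Proof.
have cap0 : (kermx W^T :&: W)%MS = 0.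
  apply/eqP/rowV0P => v.
  rewrite sub_capmx => /andP[vk vW]; apply: sqnorm_eq0; exact: dot_kermx.
have := mxrank_sum_cap (kermx W^T) W.
rewrite cap0 mxrank0 addn0 mxrank_ker mxrank_tr subnK ?rank_leq_row //.
by move=> rk; rewrite /row_full rk.
Qed.

Lemma perp_proj_compl v : (v - v *m perp_proj W <= W)%MS.
Proof. exact/proj_mx_compl_sub/submx_full/kermx_tr_add_full. Qed.

Lemma dot_perp_proj v z : (z <= W)%MS -> dot (v *m perp_proj W) z = 0.
Proof. exact/dot_kermx/proj_mx_sub. Qed.

Lemma sqnorm_perp_proj_le v z :
  (z <= W)%MS -> sqnorm (v *m perp_proj W) <= sqnorm (v - z).
Proof.
move=> zW; set p := v *m _.
have -> : v - z = p + (v - p - z) by rewrite addrA [p + _]addrC subrK.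
rewrite sqnormD dot_perp_proj ?mulr0 ?addr0 ?lerDl ?sqnorm_ge0 //.
by rewrite addmx_sub ?perp_proj_compl // eqmx_opp.
Qed.

End PerpProj.

Section LasserreVectors.
Variables (R : realType) (n t m : nat) (x : vector_family R n m).
Hypotheses (t_ge : (2 <= t)%N) (lass : lasserre_vectors t x).
Implicit Types (S T F G : {set 'I_n}) (u v z : 'I_n).

Let e := x set0 set0.

Let local_card S F : (#|S| <= 3)%N -> F \subset S -> local_assignment t S F.
Proof. by move=> cS FS; rewrite /local_assignment FS andbT (leq_trans cS). Qed.

(** The union assignment taken twice is another pair with the same union, so consistency equates the
    two inner products. *)
Lemma lasserre_union S F T G :
  local_assignment t S F -> local_assignment t T G -> (#|S :|: T| <= t.+1)%N ->
  agree S F T G -> dot (x S F) (x T G) = sqnorm (x (S :|: T) (F :|: G)).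
Proof.
case: lass => _ _ cons _ lF lG cST ag.
have lU : local_assignment t (S :|: T) (F :|: G).
  move: lF lG; rewrite /local_assignment cST => /andP[_ FS] /andP[_ GT].
  exact: setUSS.
by apply: cons; rewrite // ?setUid // /agree eqxx.
Qed.

Lemma lasserre_ge0 S F T G :
  local_assignment t S F -> local_assignment t T G -> (#|S :|: T| <= t.+1)%N ->
  0 <= dot (x S F) (x T G).
Proof.
case: (lass) => _ orth _ _ lF lG cST; case: (boolP (agree S F T G)) => ag.
  by rewrite lasserre_union ?sqnorm_ge0.
by rewrite orth.
Qed.

(* A vector is determined by its norm and its inner products with the two
   refinements, which are orthogonal. *)
Let refine_of_norm S F u :
  local_assignment t (u |: S) (u |: F) -> F \subset S -> u \notin S ->
  sqnorm (x S F) = sqnorm (x (u |: S) F) + sqnorm (x (u |: S) (u |: F)) ->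
  x S F = x (u |: S) F + x (u |: S) (u |: F).
Proof.
case: (lass) => _ orth cons _ lU FS uS nrm.
have [cU _] := andP lU.
have lS : local_assignment t S F.
  by rewrite /local_assignment FS andbT (leq_trans _ cU) // subset_leq_card // subsetUr.
have FU : F \subset u |: S by rewrite (fintype.subset_trans FS) // subsetUr.
have lF : local_assignment t (u |: S) F by rewrite /local_assignment cU.
have uF : u \notin F by apply: contra uS; apply: (fintype.subsetP FS).
have SU : S :|: (u |: S) = u |: S by rewrite setUCA setUid.
have dot0 : dot (x S F) (x (u |: S) F) = sqnorm (x (u |: S) F).
  rewrite lasserre_union ?SU ?setUid //.
  by rewrite /agree (setIidPl FU) (setIidPl FS).
have dot1 : dot (x S F) (x (u |: S) (u |: F)) = sqnorm (x (u |: S) (u |: F)).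
  rewrite lasserre_union ?SU //; first by rewrite setUCA setUid.
  rewrite /agree (setIidPl FU) setIUl (setIidPl FS).
  by rewrite (disjoint_setI0 _) ?set0U // disjoints1.
have orth01 : dot (x (u |: S) F) (x (u |: S) (u |: F)) = 0.
  apply: orth => //; rewrite /agree (setIidPl FU).
  rewrite (setIidPl _); last by case/andP: lU.
  by apply: contra uF => /eqP ->; rewrite setU11.
apply/eqP; rewrite -subr_eq0; apply/eqP/sqnorm_eq0.
by rewrite sqnormB sqnormD dotDr dot0 dot1 orth01 nrm; lra.
Qed.

Lemma lasserre_unit u : e = x [set u] set0 + x [set u] [set u].
Proof.
case: (lass) => e1 _ _ sum1.
have := @refine_of_norm set0 set0 u; rewrite !setU0; apply.
- by apply: local_card; rewrite ?cards1.
- exact: sub0set.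
- by rewrite inE.
- by rewrite e1 sum1.
Qed.

Lemma dot_unit S F : local_assignment t S F -> dot (x S F) e = sqnorm (x S F).
Proof.
move=> lF; rewrite lasserre_union ?setU0 //.
- by apply: local_card; rewrite ?cards0 ?sub0set.
- by case/andP: lF.
- by rewrite /agree setI0 set0I.
Qed.

(** The norm condition of [refine_of_norm] comes from pairing x_S(F) with e = x_u(0) + x_u(1). *)
Lemma lasserre_refine S F u :
  local_assignment t (u |: S) (u |: F) -> F \subset S -> u \notin S ->
  x S F = x (u |: S) F + x (u |: S) (u |: F).
Proof.
move=> lU FS uS; apply: refine_of_norm => //.
have [cU _] := andP lU.
have lS : local_assignment t S F.
  by rewrite /local_assignment FS andbT (leq_trans _ cU) // subset_leq_card // subsetUr.
have uF : u \notin F by apply: contra uS; apply: (fintype.subsetP FS).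
have Fu : F :&: [set u] = set0 by rewrite setIC disjoint_setI0 ?disjoints1.
have Su : [set u] :&: S = set0 by rewrite disjoint_setI0 ?disjoints1.
have single G : G \subset [set u] -> agree S F [set u] G ->
    dot (x S F) (x [set u] G) = sqnorm (x (u |: S) (F :|: G)).
  move=> Gu ag; rewrite lasserre_union // 1?setUC //.
  by apply: local_card; rewrite ?cards1.
rewrite -dot_unit // (lasserre_unit u) dotDr !single ?setU0 ?[F :|: _]setUC //.
- by rewrite /agree Fu Su.
- exact: sub0set.
- by rewrite /agree Fu set0I.
Qed.

Lemma dot_vertex_unit u : dot (vertex_vector x u) e = sqnorm (vertex_vector x u).
Proof. by apply: dot_unit; apply: local_card; rewrite ?cards1. Qed.

Let pair_card u v : (#|[set u; v]| <= 2)%N.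
Proof. by rewrite cards2; case: (u == v). Qed.

Let local_pair u v F : F \subset [set u; v] -> local_assignment t [set u; v] F.
Proof. by apply: local_card; apply: leq_trans (pair_card u v) _. Qed.

(** Both vectors are refined to the pair {u, v}, where the term assigning 1 to both cancels. The two
    terms left are orthogonal. *)
Lemma vertex_vectorB u v : u != v ->
  vertex_vector x u - vertex_vector x v =
    x [set u; v] [set u] - x [set u; v] [set v].
Proof.
move=> uv.
have splitv a b : a != b -> vertex_vector x a =
    x [set a; b] [set a] + x [set a; b] [set a; b].
  move=> ab; rewrite /vertex_vector (@lasserre_refine _ _ b) //.
  - by rewrite ![b |: [set a]]setUC.
  - by rewrite [b |: _]setUC; apply: local_pair.
  - by rewrite inE eq_sym.
rewrite (splitv u v) // (splitv v u) 1?eq_sym // [[set v; u]]setUC.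
by rewrite opprD addrACA subrr addr0.
Qed.

Let dot_pair u v : u != v -> dot (x [set u; v] [set u]) (x [set u; v] [set v]) = 0.
Proof.
move=> uv; case: (lass) => _ orth _ _; apply: orth.
- by apply: local_pair; rewrite sub1set !inE eqxx.
- by apply: local_pair; rewrite sub1set !inE eqxx orbT.
rewrite /agree !(setIidPl _) ?sub1set ?inE ?eqxx ?orbT //.
by apply: contra uv => /eqP/set1_inj ->.
Qed.

Let union3 u v z : (#|[set u; z] :|: [set v; z]| <= 3)%N.
Proof.
have -> : [set u; z] :|: [set v; z] = [set u; v] :|: [set z].
  by apply/setP => a; rewrite !inE; do 3 case: (a == _).
by rewrite (leq_trans (leq_card_setU _ _)) // cards1 addn1 ltnS.
Qed.

(** It amounts to <x_u - x_z, x_v - x_z> >= 0. After refinement the cross terms disagree at z and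
    vanish, and the other two are nonnegative. Three vertices occur together, whence t >= 2. *)
Lemma vertex_triangle u v z :
  sqnorm (vertex_vector x u - vertex_vector x v) <=
    sqnorm (vertex_vector x u - vertex_vector x z) +
    sqnorm (vertex_vector x z - vertex_vector x v).
Proof.
set a := vertex_vector x u - vertex_vector x z.
set b := vertex_vector x v - vertex_vector x z.
have -> : vertex_vector x u - vertex_vector x v = a - b.
  by rewrite opprB addrA subrK.
rewrite (sqnormBC (vertex_vector x z)) -/b sqnormB.
rewrite addrAC gerBl mulr_ge0 //.
have [uz|uz] := eqVneq u z; first by rewrite /a uz subrr dot0l.
have [vz|vz] := eqVneq v z; first by rewrite /b vz subrr dot0r.
have mem1 a' : [set a'] \subset [set a'; z] by rewrite sub1set !inE eqxx.
have memz a' : [set z] \subset [set a'; z] by rewrite sub1set !inE eqxx orbT.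
have small : (#|[set u; z] :|: [set v; z]| <= t.+1)%N by apply: leq_trans (union3 u v z) _.
have disagree a' b' : a' != z -> b' != z ->
    dot (x [set a'; z] [set a']) (x [set b'; z] [set z]) = 0.
  move=> a'z b'z; case: (lass) => _ orth _ _; apply: orth; rewrite ?local_pair //.
  apply/negP => /eqP/setP/(_ z); rewrite !inE eqxx !orbT !andbT.
  by rewrite eq_sym (negPf a'z).
rewrite /a /b !vertex_vectorB // dotBl !dotBr (disagree u v) //.
rewrite (dotC (x [set u; z] [set z]) (x [set v; z] [set v])) (disagree v u) //.
by rewrite subr0 sub0r opprK addr_ge0 // lasserre_ge0 // ?local_pair.
Qed.

Let local_single z F : F \subset [set z] -> local_assignment t [set z] F.
Proof. by apply: local_card; rewrite ?cards1. Qed.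

Lemma dot_single_bounds z F u : F \subset [set z] ->
  0 <= dot (x [set z] F) (vertex_vector x u) <= sqnorm (x [set z] F).
Proof.
move=> Fz.
have ge0 G : G \subset [set u] -> 0 <= dot (x [set z] F) (x [set u] G).
  move=> Gu; apply: lasserre_ge0; try by apply: local_card; rewrite ?cards1.
  by rewrite (leq_trans (leq_card_setU _ _)) // !cards1 ltnS ltnW.
rewrite ge0 //= -dot_unit ?local_single // (lasserre_unit u) dotDr lerDr.
by rewrite ge0 // sub0set.
Qed.

(** For p, q the orthogonal parts of x_u - x_v, each absolute value is at most the sum of the inner
    products with p and q. The two seed vectors add up to e, so the total is |p|^2 + |q|^2. Hence
    rounding costs at most the relaxation in mean. *)
Lemma sum_dot_single_le z u v :
  `|dot (x [set z] set0) (vertex_vector x u - vertex_vector x v)| +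
  `|dot (x [set z] [set z]) (vertex_vector x u - vertex_vector x v)| <=
  sqnorm (vertex_vector x u - vertex_vector x v).
Proof.
have [->|uv] := eqVneq u v; first by rewrite subrr !dot0r normr0 addr0 sqnorm_ge0.
rewrite vertex_vectorB // sqnormB dot_pair // mulr0 subr0.
set p := x _ [set u]; set q := x _ [set v].
have luv : [set u] \subset [set u; v] by rewrite sub1set !inE eqxx.
have lvv : [set v] \subset [set u; v] by rewrite sub1set !inE eqxx orbT.
have ge0 F G : F \subset [set z] -> G \subset [set u; v] ->
    0 <= dot (x [set z] F) (x [set u; v] G).
  move=> Fz Guv; apply: lasserre_ge0; rewrite ?local_single ?local_pair //.
  rewrite (leq_trans (leq_card_setU _ _)) // cards1 add1n ltnS.
  exact: leq_trans (pair_card u v) _.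
have absB F : F \subset [set z] -> `|dot (x [set z] F) (p - q)| <=
    dot (x [set z] F) p + dot (x [set z] F) q.
  move=> Fz; rewrite dotBr; apply: le_trans (ler_normB _ _) _.
  by rewrite !ger0_norm // ge0.
apply: le_trans (lerD (absB set0 (sub0set _)) (absB [set z] (fintype.subxx _))) _.
rewrite addrACA -!dotDl -lasserre_unit ![dot e _]dotC.
by rewrite !dot_unit // local_pair.
Qed.

End LasserreVectors.

(** * Sparsity and integral solutions *)

Lemma sum_lt_sym (R : realType) (n : nat) (F : 'I_n -> 'I_n -> R) :
  (forall u v, F u v = F v u) -> (forall u, F u u = 0) ->
  \sum_u \sum_v F u v = 2 * \sum_(u < n) \sum_(v < n | (u < v)%N) F u v.
Proof.
move=> FC F0; rewrite mulr_natl mulr2n.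
rewrite [X in _ = X + _](exchange_big_dep xpredT) //= -big_split /=.
apply: eq_bigr => u _; rewrite (bigID (fun v : 'I_n => (u < v)%N)) /= addrC.
congr (_ + _); rewrite (bigD1 u) ?ltnn //= F0 add0r.
apply: eq_big => [v|v _]; last exact: FC.
by rewrite -leqNgt ltn_neqAle andbC.
Qed.

Section Sparsity.
Variables (R : realType) (n : nat) (C : 'I_n -> 'I_n -> R).
Hypothesis regC : regular_graph C.
Implicit Types (A : {set 'I_n}).

Let C_ge0 u v : 0 <= C u v. Proof. by case: regC. Qed.

Let C_sym u v : C u v = C v u. Proof. by case: regC. Qed.

Lemma edge_weight_ge0 A B : 0 <= edge_weight C A B.
Proof. by apply: sumr_ge0 => u _; apply: sumr_ge0 => v _; apply: C_ge0. Qed.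

Lemma edge_weightC A B : edge_weight C A B = edge_weight C B A.
Proof.
rewrite /edge_weight exchange_big; apply: eq_bigr => u _.
by apply: eq_bigr => v _; apply: C_sym.
Qed.

Lemma card_setC_natr A : #|~: A|%:R = n%:R - #|A|%:R :> R.
Proof.
have := congr1 (fun k => k%:R : R) (cardsC A).
by rewrite card_ord natrD => <-; ring.
Qed.

Lemma natr_subn_card A : (n - #|A|)%:R = n%:R - #|A|%:R :> R.
Proof. by rewrite natrB //; have := max_card (mem A); rewrite card_ord. Qed.

Lemma sparsityC A : sparsity C (~: A) = sparsity C A.
Proof.
rewrite /sparsity edge_weightC setCK !natr_subn_card card_setC_natr.
by congr (_ / _); ring.
Qed.

Lemma sparsity_ge0 A : 0 <= sparsity C A.
Proof. by rewrite divr_ge0 ?mulr_ge0 ?edge_weight_ge0. Qed.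

Lemma sparsest_le A : is_cut A -> sparsest C <= sparsity C A.
Proof.
move=> cutA; apply: ge_inf; last by exists A.
by exists 0 => _ [B _ <-]; apply: sparsity_ge0.
Qed.

Lemma sparsest_ge A (s : R) : is_cut A ->
  (forall B, is_cut B -> s <= sparsity C B) -> s <= sparsest C.
Proof.
move=> cutA les; apply: lb_le_inf; first by exists (sparsity C A); exists A.
by move=> _ [B cutB <-]; apply: les.
Qed.

Lemma is_cut_card A : is_cut A -> 0 < #|A|%:R :> R /\ 0 < #|~: A|%:R :> R.
Proof.
move=> [A0 AT]; rewrite !ltr0n !card_gt0; split=> //.
by apply: contra AT => /eqP h; rewrite -(setCK A) h setC0.
Qed.

(** The integral solution of the cut A, in dimension 1. *)
Definition cut_family A : vector_family R n 1 :=
  fun S F => const_mx (A :&: S == F)%:R.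

Lemma dot_cut_family A S F T G :
  dot (cut_family A S F) (cut_family A T G) = ((A :&: S == F) && (A :&: T == G))%:R.
Proof. by rewrite /dot big_ord1 !mxE -natrM mulnb. Qed.

Lemma cut_family_union A (S F T G : {set 'I_n}) : F \subset S -> G \subset T -> agree S F T G ->
  (A :&: S == F) && (A :&: T == G) = (A :&: (S :|: T) == F :|: G).
Proof.
move=> FS GT /eqP ag; apply/andP/eqP => [[/eqP <- /eqP <-]|AU]; first by rewrite setIUr.
split; apply/eqP.
  have -> : A :&: S = (A :&: (S :|: T)) :&: S by rewrite -setIA setUK.
  by rewrite AU setIUl -ag (setIidPl FS) [F :&: T]setIC setKI.
have -> : A :&: T = (A :&: (S :|: T)) :&: T by rewrite -setIA [S :|: T]setUC setUK.
by rewrite AU setIUl ag (setIidPl GT) setUC [G :&: S]setIC setKI.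
Qed.

Lemma lasserre_cut_family t A : lasserre_vectors t (cut_family A).
Proof.
split.
- by rewrite /sqnorm dot_cut_family setI0 eqxx.
- move=> S F T G _ _ dis; rewrite dot_cut_family.
  case: eqP => //= FE; case: eqP => //= GE; case/negP: dis.
  by rewrite /agree -FE -GE -!setIA [S :&: T]setIC.
- move=> S F T G A' F' B' G' /andP[_ FS] /andP[_ GT] /andP[_ FA] /andP[_ GB] ag ag' eS eF.
  by rewrite !dot_cut_family !cut_family_union // eS eF.
move=> u; rewrite /sqnorm !dot_cut_family !andbb.
have [uA|uA] := boolP (u \in A).
  rewrite (setIidPr _) ?sub1set // eqxx (_ : [set u] == set0 = false) ?add0r //.
  by apply/negP => /eqP/setP/(_ u); rewrite !inE eqxx.
have -> : A :&: [set u] = set0 by rewrite setIC disjoint_setI0 ?disjoints1.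
rewrite eqxx (_ : set0 == [set u] = false) ?addr0 //.
by apply/negP => /eqP/setP/(_ u); rewrite !inE eqxx.
Qed.

Lemma vertex_cut_family A u : vertex_vector (cut_family A) u = const_mx (u \in A)%:R.
Proof.
rewrite /vertex_vector /cut_family; congr (const_mx _%:R); congr (nat_of_bool _).
by rewrite setIC -sub1set; apply/eqP/setIidPl.
Qed.

Lemma cut_family_feasible t A : is_cut A -> (#|A|.*2 <= n)%N ->
  lasserre_feasible t #|A| (cut_family A).
Proof.
move=> [A0 _] An; split; rewrite ?card_gt0 //; first exact: lasserre_cut_family.
rewrite (eq_bigr (fun u => const_mx (u \in A)%:R)); last first.
  by move=> u _; rewrite vertex_cut_family.
apply/rowP => i; rewrite !mxE summxE setI0 eqxx mulr1 mulrC; congr (_ / _).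
under eq_bigr do rewrite mxE.
by rewrite -natr_sum -sum1_card [in RHS]big_mkcond; congr _%:R; apply: eq_bigr => u _; case: (u \in A).
Qed.

Lemma cut_family_objective A :
  lasserre_objective C #|A| (cut_family A) = sparsity C A.
Proof.
(* For n = 0 both sides are 0, the left one through 0^-1 = 0. *)
have [nR|nR] := eqVneq n%:R (0 : R).
  by rewrite /lasserre_objective /sparsity nR !mul0r invr0 mul0r.
rewrite /lasserre_objective.
have sumE : \sum_(u < n) \sum_(v < n | (u < v)%N)
    C u v * sqnorm (vertex_vector (cut_family A) u - vertex_vector (cut_family A) v)
    = edge_weight C A (~: A).
  pose G (u v : 'I_n) := C u v * ((u \in A) != (v \in A))%:R.
  have GE u v : C u v * sqnorm (vertex_vector (cut_family A) u -
      vertex_vector (cut_family A) v) = G u v.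
    rewrite !vertex_cut_family /sqnorm /dot big_ord1 !mxE /G; congr (_ * _).
    by do 2 case: (_ \in A); rewrite /=; ring.
  under eq_bigr do under eq_bigr do rewrite GE.
  have : \sum_u \sum_v G u v = 2 * edge_weight C A (~: A).
    rewrite mulr_natl mulr2n {2}edge_weightC (bigID (mem A)) /=; congr (_ + _).
      apply: eq_bigr => u uA; rewrite (bigID (mem A)) /= big1 ?add0r.
        apply: eq_big => [v|v vA]; first by rewrite !inE.
        by rewrite /G uA (negPf vA) mulr1.
      by move=> v vA; rewrite /G uA vA mulr0.
    rewrite /edge_weight; apply: eq_big => [u|u uA]; first by rewrite !inE.
    rewrite (bigID (mem A)) /= [X in _ + X]big1 ?addr0.
      by apply: eq_bigr => v vA; rewrite /G (negPf uA) vA mulr1.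
    by move=> v vA; rewrite /G (negPf uA) (negPf vA) mulr0.
  rewrite sum_lt_sym; first by move=> h; lra.
    by move=> u v; rewrite /G C_sym eq_sym.
  by move=> u; rewrite /G eqxx mulr0.
rewrite sumE /sparsity natr_subn_card.
have -> : n%:R * (#|A|%:R / n%:R) * (1 - #|A|%:R / n%:R) =
    #|A|%:R * (n%:R - #|A|%:R) / n%:R :> R by field.
by rewrite invf_div mulrAC.
Qed.

Lemma lasserre_objective_le_sparsity t m k (x : vector_family R n m) A :
  lasserre_optimal t C k x -> is_cut A -> lasserre_objective C k x <= sparsity C A.
Proof.
(* Since mu is at most 1/2, a larger side is exchanged for its complement. *)
move=> [_ opt]; wlog An : A / (#|A|.*2 <= n)%N.
  move=> small cutA; have [An|nA] := leqP #|A|.*2 n; first exact: small.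
  rewrite -sparsityC; apply: small.
    have := cardsC A; rewrite card_ord; move: nA; lia.
  move: cutA => [A0 AT]; split.
    by apply: contra AT => /eqP h; rewrite -(setCK A) h setC0.
  by apply: contra A0 => /eqP h; rewrite -(setCK A) h setCT.
by move=> cutA; rewrite -cut_family_objective; apply/opt/cut_family_feasible.
Qed.

End Sparsity.

(** * Rounding from one seed *)

(** Coarea for the signed weight n C - s; empty and full level sets contribute no deficit. It serves
    with s = phi for every sample and s = (1 + eps) phi for a failing one. *)
Lemma sum_threshold_le (R : realType) (n : nat) (C : 'I_n -> 'I_n -> R)
    (y : 'I_n -> R) (s : R) :
  regular_graph C ->
  (forall tau, is_cut [set u | tau <= y u] -> s <= sparsity C [set u | tau <= y u]) ->
  s * (\sum_u \sum_v `|y u - y v|) <= n%:R * (\sum_u \sum_v C u v * `|y u - y v|).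
Proof.
move=> regC les; have [C0 CC _] := regC; rewrite -subr_ge0 !mulr_sumr -sumrB.
rewrite (eq_bigr (fun u => \sum_(v in [set: 'I_n]) (n%:R * C u v - s) * `|y u - y v|)).
  rewrite (eq_bigl (fun u => u \in [set: 'I_n])) => [|u]; last by rewrite inE.
  apply: coarea => [u v|tau]; first by rewrite CC.
  set A := [set u | tau <= y u].
  rewrite (eq_bigl (fun u => u \in A)) => [|u]; last by rewrite !inE.
  rewrite (eq_bigr (fun u => n%:R * (\sum_(v in ~: A) C u v) - s * #|~: A|%:R)).
    rewrite sumrB -mulr_sumr sumr_const -[X in _ - X]mulr_natl -/(edge_weight C A (~: A)).
    have [A0|A0] := eqVneq A set0.
      by rewrite A0 cards0 mul0r subr0 mulr_ge0 ?(edge_weight_ge0 regC).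
    have [AT|AT] := eqVneq A [set: 'I_n].
      by rewrite AT setCT cards0 mulr0 mulr0 subr0 mulr_ge0 ?(edge_weight_ge0 regC).
    have [a0 b0] := is_cut_card R (conj A0 AT : is_cut A).
    have := les tau (conj A0 AT); rewrite -/A /sparsity natr_subn_card -card_setC_natr.
    by rewrite ler_pdivlMr ?mulr_gt0 // => h; rewrite subr_ge0; lra.
  move=> u _; rewrite (eq_bigl (fun v => v \in ~: A)) => [|v]; last by rewrite !inE ltNge.
  by rewrite sumrB -mulr_sumr sumr_const -[X in _ - X = _]mulr_natr.
move=> u _; rewrite !mulr_sumr -sumrB; apply: eq_big => [v|v _]; first by rewrite inE.
by ring.
Qed.

Lemma sum_powerset1 (R : realType) (I : finType) (z : I) (g : {set I} -> R) :
  \sum_(F in powerset [set z]) g F = g set0 + g [set z].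
Proof.
have -> : powerset [set z] = [set set0; [set z]].
  apply/setP => F; rewrite !inE subset1 orbC.
  by rewrite orbC; case: (F == set0); case: (F == [set z]).
rewrite big_setU1 ?big_set1 // inE; apply/negP => /eqP/setP/(_ z).
by rewrite !inE eqxx.
Qed.

Section Rounding.
Variables (R : realType) (n t m k : nat) (C : 'I_n -> 'I_n -> R).
Variables (x : vector_family R n m) (z : 'I_n).
Hypotheses (regC : regular_graph C) (t_ge : (2 <= t)%N).
Hypothesis feas : lasserre_feasible t k x.
Implicit Types (F : {set 'I_n}) (u v : 'I_n).

Let e := x set0 set0.
Let mu : R := k%:R / n%:R.
Let lass : lasserre_vectors t x. Proof. by case: feas. Qed.
Let a F := x [set z] F.
Let w F : R := sqnorm (a F).
Let y F u : R := rounding_value x [set z] F u.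
Let spread F : R := \sum_u \sum_v `|y F u - y F v|.
Let cost F : R := \sum_u \sum_v C u v * `|y F u - y F v|.
Let Q : R := \sum_u \sum_v C u v * sqnorm (vertex_vector x u - vertex_vector x v).
(** The spread of an integral cut with k vertices on one side, counted over ordered pairs. *)
Let D : R := 2 * k%:R * (n%:R - k%:R).
Let err : R := projection_error x (seed_span x [set z]).

Let n_gt0 : 0 < n%:R :> R.
Proof. by rewrite ltr0n; apply: leq_ltn_trans (ltn_ord z). Qed.

Let k_gt0 : 0 < k%:R :> R. Proof. by rewrite ltr0n; case: feas. Qed.

Let k_le : 2 * k%:R <= n%:R :> R.
Proof. by rewrite -natrM ler_nat mul2n; case: feas. Qed.

Let nmu : n%:R * mu = k%:R. Proof. by rewrite /mu mulrC divfK ?gt_eqF. Qed.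

Lemma sum_vertex_vector : \sum_u vertex_vector x u = k%:R *: e.
Proof.
case: feas => _ _ _ mean; rewrite -nmu -scalerA -/mu -mean scalerA.
by rewrite mulfV ?scale1r // gt_eqF.
Qed.

Lemma centered_vectorE u : centered_vector x u = vertex_vector x u - mu *: e.
Proof. by case: feas => _ _ _ mean; rewrite /centered_vector mean. Qed.

Let w_ge0 F : 0 <= w F. Proof. exact: sqnorm_ge0. Qed.

Let dot_a F u : dot (a F) (vertex_vector x u) = w F * y F u.
Proof.
rewrite /y /rounding_value -/(a F) -/(w F).
(* An assignment of probability zero has a zero vector, so the default value of the quotient is
   harmless. *)
have [w0|w0] := eqVneq (w F) 0; last by rewrite mulrC divfK.
by rewrite w0 mul0r (sqnorm_eq0 w0) dot0l.
Qed.

Let local_z F : F \subset [set z] -> local_assignment t [set z] F.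
Proof. by move=> Fz; rewrite /local_assignment Fz cards1. Qed.

Let dot_a_unit F : F \subset [set z] -> dot (a F) e = w F.
Proof. by move=> Fz; apply: (dot_unit t_ge lass (local_z Fz)). Qed.

Let y_bounds F u : F \subset [set z] -> 0 <= y F u <= 1.
Proof.
move=> Fz; have /andP[ge0 le1] := dot_single_bounds t_ge lass u Fz.
rewrite /y /rounding_value divr_ge0 ?sqnorm_ge0 //=.
have := sqnorm_ge0 (x [set z] F); rewrite le_eqVlt => /orP[/eqP <-|w0].
  by rewrite invr0 mulr0 ler01.
by rewrite ler_pdivrMr // mul1r.
Qed.

Let sum_y F : F \subset [set z] -> w F != 0 -> \sum_u y F u = k%:R.
Proof.
move=> Fz w0; apply: (mulfI w0); rewrite mulr_sumr.
under eq_bigr do rewrite -dot_a.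
by rewrite -dot_sumr sum_vertex_vector dotZr dot_a_unit // mulrC.
Qed.

Let w_sum : w set0 + w [set z] = 1.
Proof. by case: lass => _ _ _; apply. Qed.

(** On [0, 1], |a - b| <= a (1 - b) + b (1 - a), and the right sides sum to D because the values sum
    to k. *)
Let spread_le F : F \subset [set z] -> w F * spread F <= w F * D.
Proof.
move=> Fz; have [->|w0] := eqVneq (w F) 0; first by rewrite !mul0r.
apply: ler_wpM2l => //.
apply: le_trans (_ : _ <= \sum_u \sum_v (y F u * (1 - y F v) + y F v * (1 - y F u))) _.
  apply: ler_sum => u _; apply: ler_sum => v _.
  have /andP[u0 u1] := y_bounds u Fz; have /andP[v0 v1] := y_bounds v Fz.
  by rewrite ler_norml; apply/andP; split; nra.
have sumE : \sum_u \sum_v (y F u * (1 - y F v)) = k%:R * (n%:R - k%:R).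
  under eq_bigr do rewrite -mulr_sumr sumrB sum_y // sumr_const card_ord.
  by rewrite -mulr_suml sum_y.
rewrite (eq_bigr (fun u => \sum_v (y F u * (1 - y F v)) + \sum_v (y F v * (1 - y F u)))).
  by rewrite big_split /= [X in _ + X]exchange_big /= sumE /D; lra.
by move=> u _; rewrite big_split.
Qed.

Let cost_le : w set0 * cost set0 + w [set z] * cost [set z] <= Q.
Proof.
rewrite !mulr_sumr -big_split; apply: ler_sum => u _ /=.
rewrite !mulr_sumr -big_split; apply: ler_sum => v _ /=.
have [C0 _ _] := regC.
rewrite !(mulrCA _ (C u v)) -mulrDr ler_wpM2l //.
apply: le_trans _ (sum_dot_single_le t_ge lass z u v).
rewrite -!/(a _) !dotBr !dot_a -!mulrBr !normrM.
by rewrite !(ger0_norm (w_ge0 _)).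
Qed.

Let aE : e = a set0 + a [set z]. Proof. exact: (lasserre_unit t_ge lass). Qed.

Let dot_a01 : dot (a set0) (a [set z]) = 0.
Proof.
case: lass => _ orth _ _; apply: orth; rewrite ?local_z ?sub0set //.
by rewrite /agree setIid set0I; apply/negP => /eqP/setP/(_ z); rewrite !inE eqxx.
Qed.

Let sqnorm_centered : \sum_u sqnorm (centered_vector x u) = D / 2 / n%:R.
Proof.
have normE u : sqnorm (centered_vector x u) =
    (1 - 2 * mu) * dot (vertex_vector x u) e + mu ^+ 2.
  rewrite centered_vectorE sqnormB sqnormZ dotZr (dot_vertex_unit t_ge lass).
  by case: (lass) => -> _ _ _; ring.
under eq_bigr do rewrite normE.
rewrite big_split /= -mulr_sumr -dot_suml sum_vertex_vector dotZl sumr_const card_ord.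
have -> : dot e e = 1 by case: lass.
rewrite -[X in _ + X]mulr_natl /D /mu; field.
by rewrite gt_eqF.
Qed.

(* The rows of [seed_span] lie in the span of the [a F], on which [w F (y F - mu)]
   are the coordinates of the projection: Bessel's inequality. *)
Let projection_le u :
  sqnorm (centered_vector x u) - sqnorm (centered_vector x u *m perp_proj (seed_span x [set z]))
  <= w set0 * (y set0 u - mu) ^+ 2 + w [set z] * (y [set z] u - mu) ^+ 2.
Proof.
have [X XE] : exists X, X = centered_vector x u by eexists.
rewrite -XE; set P := perp_proj _.
have /sub_rVP[b Xb] : (X - X *m P <= centered_vector x z)%MS.
  by have := perp_proj_compl (seed_span x [set z]) X; rewrite {2}/seed_span big_set1 genmxE.
have -> : X *m P = X - (b * (1 - mu)) *: a [set z] + (b * mu) *: a set0.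
  rewrite -[LHS](subKr X) Xb centered_vectorE aE.
  rewrite (_ : vertex_vector x z = a [set z]) //.
  apply/rowP => i; rewrite !mxE; ring.
have dotX F : F \subset [set z] -> dot X (a F) = w F * (y F u - mu).
  by move=> Fz; rewrite XE centered_vectorE dotC dotBr dotZr dot_a dot_a_unit //; ring.
rewrite sqnormD sqnormB !sqnormZ dotBl !dotZl !dotZr (dotC (a [set z])) dot_a01.
rewrite !dotX ?sub0set // -!/(w _).
have h0 := mulr_ge0 (w_ge0 set0) (sqr_ge0 (y set0 u - mu + b * mu)).
have h1 := mulr_ge0 (w_ge0 [set z]) (sqr_ge0 (y [set z] u - mu - b * (1 - mu))).
lra.
Qed.

(** As |h| >= h^2 for |h| <= 1, the spread is at least 2 n times the sum of squares about mu. In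
    mean over F these squares capture the total variance D / (2 n) of the centered vectors, up to
    the projection error. *)
Let spread_ge : D - 2 * n%:R * err <= w set0 * spread set0 + w [set z] * spread [set z].
Proof.
have spreadF F : F \subset [set z] ->
    2 * n%:R * \sum_u (w F * (y F u - mu) ^+ 2) <= w F * spread F.
  move=> Fz; rewrite -mulr_sumr mulrCA.
  have [->|w0] := eqVneq (w F) 0; first by rewrite !mul0r.
  apply: ler_wpM2l => //.
  apply: le_trans (_ : _ <= \sum_u \sum_v (y F u - y F v) ^+ 2) _; last first.
    apply: ler_sum => u _; apply: ler_sum => v _.
    rewrite -[X in X <= _]real_normK ?num_real // expr2.
    apply: ler_piMr; rewrite ?normr_ge0 // ler_norml.
    have /andP[u0 u1] := y_bounds u Fz; have /andP[v0 v1] := y_bounds v Fz.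
    by apply/andP; split; lra.
  have sumE : \sum_u (y F u - mu) ^+ 2 = \sum_u y F u ^+ 2 - n%:R * mu ^+ 2.
    rewrite (eq_bigr (fun u => y F u ^+ 2 - ((2 * mu) * y F u - mu ^+ 2))); last first.
      by move=> u _; ring.
    rewrite sumrB sumrB -mulr_sumr sum_y // sumr_const card_ord -nmu.
    by rewrite -[_ *+ n]mulr_natl; ring.
  have sumE2 : \sum_u \sum_v (y F u - y F v) ^+ 2 =
      2 * n%:R * (\sum_u y F u ^+ 2) - 2 * (n%:R * mu) ^+ 2.
    rewrite (eq_bigr (fun u => n%:R * y F u ^+ 2 - (2 * k%:R * y F u - \sum_v y F v ^+ 2))).
      rewrite !sumrB -!mulr_sumr sum_y // sumr_const card_ord -nmu.
      by rewrite -[_ *+ n]mulr_natl; ring.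
    move=> u _.
    rewrite (eq_bigr (fun v => y F u ^+ 2 - ((2 * y F u) * y F v - y F v ^+ 2))); last first.
      by move=> v _; ring.
    rewrite !sumrB sumr_const card_ord -mulr_sumr sum_y // -[_ *+ n]mulr_natl.
    by ring.
  by rewrite sumE sumE2 le_eqVlt; apply/orP; left; apply/eqP; ring.
have h0 := spreadF set0 (sub0set _); have h1 := spreadF [set z] (fintype.subxx _).
apply: le_trans (lerD h0 h1); rewrite -mulrDr -big_split /=.
have -> : D = 2 * n%:R * \sum_u sqnorm (centered_vector x u).
  by rewrite sqnorm_centered; field; rewrite gt_eqF.
rewrite -mulrBr /err /projection_error -sumrB; apply: ler_wpM2l.
  by rewrite mulr_ge0 // ltW.
by apply: ler_sum => u _; apply: projection_le.
Qed.

Lemma lasserre_costE : Q = 2 * (n%:R * mu * (1 - mu)) * lasserre_objective C k x.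
Proof.
rewrite /lasserre_objective -/mu -[RHS]mulrA mulVKf; last first.
  rewrite nmu mulf_neq0 ?gt_eqF // subr_gt0 /mu ltr_pdivrMr // mul1r.
  by have := k_gt0; have := k_le; lra.
rewrite /Q sum_lt_sym // => [u v|u]; last by rewrite subrr sqnorm0 mulr0.
by rewrite sqnormBC; case: regC => _ -> _.
Qed.

Hypothesis optimal : forall A, is_cut A -> lasserre_objective C k x <= sparsity C A.

(** A witness that cuts exist, so that the infimum [sparsest] can be bounded below. *)
Let A0 : is_cut [set z].
Proof.
split; first by rewrite -card_gt0 cards1.
apply/eqP => zT; have : (#|[set z]| = n) by rewrite zT cardsT card_ord.
by rewrite cards1 => n1; have := k_gt0; have := k_le; rewrite -n1; rewrite ltr0n -natrM ler_nat; lia.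
Qed.

Let D_gt0 : 0 < D.
Proof. by have := k_gt0; have := k_le; rewrite /D => h1 h2; rewrite !mulr_gt0 //; lra. Qed.

Let cost_sparsest : n%:R * Q <= sparsest C * D.
Proof.
have le_obj : lasserre_objective C k x <= sparsest C := sparsest_ge A0 optimal.
rewrite lasserre_costE /D.
have -> : n%:R * (2 * (n%:R * mu * (1 - mu)) * lasserre_objective C k x) =
   (2 * k%:R * (n%:R - k%:R)) * lasserre_objective C k x.
  by rewrite /mu; field; rewrite gt_eqF.
by rewrite mulrC; apply: ler_wpM2r => //; rewrite ltW.
Qed.

Let success_probabilityE (eps : R) :
  success_probability x C eps [set z] =
    w set0 * `[< rounding_succeeds x C eps [set z] set0 >]%:R +
    w [set z] * `[< rounding_succeeds x C eps [set z] [set z] >]%:R.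
Proof.
rewrite -(sum_powerset1 z (fun F => w F * `[< rounding_succeeds x C eps [set z] F >]%:R)).
rewrite /success_probability big_mkcondr; apply: eq_bigr => F _.
by case: ifP; rewrite ?mulr1 ?mulr0.
Qed.

(** Write D = (D - spread F) + spread F. The first part is nonnegative whenever F has positive
    weight, and on failure the second is at most the excess n cost - phi spread divided by eps phi.
    In mean they give at most 2 n err and 2 n err / eps, each at most D / 6, so failure has
    probability at most 1/3. *)
Lemma success_probability_ge (eps : R) :
  0 < eps -> eps < 1 -> 0 < sparsest C -> 6 * n%:R * err <= eps * (k%:R * (n%:R - k%:R)) ->
  2 / 3 <= success_probability x C eps [set z].
Proof.
move=> eps0 eps1 phi0 err_le; rewrite success_probabilityE.
set phi := sparsest C in phi0.
pose ok F : R := `[< rounding_succeeds x C eps [set z] F >]%:R.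
have fail_le F : F \subset [set z] ->
    w F * (1 - ok F) * D <= w F * (D - spread F) +
      (eps * phi)^-1 * (w F * (n%:R * cost F - phi * spread F)).
  move=> Fz.
  have le_cost : phi * spread F <= n%:R * cost F.
    by apply: sum_threshold_le => // tau; exact: sparsest_le.
  have wD : 0 <= w F * (D - spread F) by rewrite mulrBr subr_ge0 spread_le.
  rewrite /ok; case: asboolP => [_|nosucc]; rewrite ?subrr ?subr0.
    rewrite mulr0 mul0r addr_ge0 //; apply: mulr_ge0.
      by rewrite invr_ge0 ltW // mulr_gt0.
    by rewrite mulr_ge0 // subr_ge0.
  (* On failure every threshold cut has sparsity above (1 + eps) phi. *)
  have le_cost' : (1 + eps) * phi * spread F <= n%:R * cost F.
    apply: sum_threshold_le => // tau cutA; rewrite leNgt; apply/negP => lt_phi.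
    by apply: nosucc; exists tau; split => //; apply: ltW.
  have : spread F <= (eps * phi)^-1 * (n%:R * cost F - phi * spread F).
    by rewrite mulrC ler_pdivlMr ?mulr_gt0 //; lra.
  by move=> /(ler_wpM2l (w_ge0 F)); lra.
have f0 := fail_le set0 (sub0set _); have f1 := fail_le [set z] (fintype.subxx _).
have eq1 : (eps * phi)^-1 * (n%:R * Q - phi * (D - 2 * n%:R * err)) <= eps^-1 * (2 * n%:R * err).
  rewrite invfM mulrC -(mulrC phi^-1) mulrA; rewrite mulrC ler_pM2l ?invr_gt0 //.
  by rewrite ler_pdivrMr //; have := cost_sparsest; rewrite -/phi; lra.
have eq2 : w set0 * (n%:R * cost set0 - phi * spread set0) +
   w [set z] * (n%:R * cost [set z] - phi * spread [set z])
   <= n%:R * Q - phi * (D - 2 * n%:R * err).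
  have h1 := ler_wpM2l (ltW n_gt0) cost_le; have h2 := ler_wpM2l (ltW phi0) spread_ge.
  lra.
have i0 : 0 < (eps * phi)^-1 by rewrite invr_gt0 mulr_gt0.
have eq3 := ler_wpM2l (ltW i0) eq2.
have eq4 : eps^-1 * (2 * n%:R * err) <= D / 6.
  by rewrite mulrC ler_pdivrMr // /D; lra.
have err0 : 0 <= err by apply: sumr_ge0 => u _; apply: sqnorm_ge0.
have eq5 : 2 * n%:R * err <= D / 6.
  apply: le_trans eq4; apply: ler_peMl; first by rewrite !mulr_ge0 // ltW.
  by rewrite invf_ge1 // ltW.
have D0 := D_gt0; have w1 := w_sum; have sp := spread_ge.
rewrite -/(ok _) -/(ok _).
suff : (1 - (w set0 * ok set0 + w [set z] * ok [set z])) * D <= D / 3.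
  by have -> : D / 3 = 1 / 3 * D; [field|rewrite ler_pM2r //; lra].
have w1D : w set0 * D + w [set z] * D = D by rewrite -mulrDl w1 mul1r.
lra.
Qed.

(** The Markov argument divides by phi, so phi = 0 is separate. Then every F of positive weight has
    cost 0, and any nonconstant [y F] has a threshold cut of sparsity 0. A constant one would equal
    k / n, strictly between 0 and 1, whereas its value at the seed is 0 or 1. *)
Lemma success_probability_degenerate (eps : R) :
  sparsest C = 0 -> success_probability x C eps [set z] = 1.
Proof.
move=> phi0; rewrite success_probabilityE -[RHS]w_sum.
have [C0 CC _] := regC.
have cost_ge0 F : 0 <= cost F.
  by apply: sumr_ge0 => u _; apply: sumr_ge0 => v _; rewrite mulr_ge0.
have Q0 : Q <= 0.
  by have := cost_sparsest; rewrite phi0 mul0r pmulr_rle0.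
have wc0 F : F \subset [set z] -> w F * cost F = 0.
  move=> Fz; apply/le_anti; rewrite mulr_ge0 // andbT.
  have := cost_le; have h0 := mulr_ge0 (w_ge0 set0) (cost_ge0 set0).
  have h1 := mulr_ge0 (w_ge0 [set z]) (cost_ge0 [set z]).
  by move: Fz; rewrite subset1 => /orP[] /eqP ->; lra.
have succ F : F \subset [set z] -> y F z * (1 - y F z) = 0 -> w F != 0 ->
    rounding_succeeds x C eps [set z] F.
  move=> Fz yz w0.
  have cost0 : cost F = 0.
    by apply/eqP; have /eqP := wc0 F Fz; rewrite mulf_eq0 (negPf w0).
  have [/existsP[u /existsP[v vu]]|const] := boolP [exists u, exists v, y F v < y F u].
    have cutA : is_cut (threshold_set x [set z] F (y F u)).
      split; first by apply/set0Pn; exists u; rewrite inE lexx.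
      by apply/negP => /eqP/setP/(_ v); rewrite !inE leNgt vu.
    exists (y F u); split => //; rewrite phi0 mulr0 /sparsity.
    suff -> : edge_weight C (threshold_set x [set z] F (y F u))
        (~: threshold_set x [set z] F (y F u)) = 0 by rewrite mulr0 mul0r.
    apply: big1 => a' aA; apply: big1 => b' bA.
    have : \sum_i C a' i * `|y F a' - y F i| = 0.
      move/eqP: cost0; rewrite /cost psumr_eq0 => [/allP/(_ a' (mem_index_enum _))/eqP //|i _].
      by apply: sumr_ge0 => j _; rewrite mulr_ge0.
    move/eqP; rewrite psumr_eq0 => [|i _]; last by rewrite mulr_ge0.
    move=> /allP/(_ b' (mem_index_enum _)) /=; rewrite mulf_eq0 normr_eq0 subr_eq0.
    case/orP => /eqP // yab; move: aA bA; rewrite !inE -!/(y F _) yab.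
    by move=> ->.
  have yE u : y F u = y F z.
    apply/le_anti; rewrite !leNgt; apply/andP; split; apply: contra const => lt;
      by apply/existsP; eexists; apply/existsP; eexists; exact: lt.
  have := sum_y Fz w0; under eq_bigr do rewrite yE.
  rewrite sumr_const card_ord -[_ *+ n]mulr_natl => ky.
  have k0 := k_gt0; have k2 := k_le.
  have : n%:R * y F z * (n%:R * (1 - y F z)) = 0 by rewrite mulrACA yz mulr0.
  rewrite ky mulrBr mulr1 ky => /eqP; rewrite mulf_eq0 !gt_eqF //; lra.
have one F : F \subset [set z] -> y F z * (1 - y F z) = 0 ->
    w F * `[< rounding_succeeds x C eps [set z] F >]%:R = w F.
  move=> Fz yz; have [->|w0] := eqVneq (w F) 0; first by rewrite mul0r.
  by case: asboolP => [_|]; [rewrite mulr1 | case; apply: succ].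
congr (_ + _); apply: one; rewrite ?sub0set //.
  by rewrite /y /rounding_value -/(a _) dot_a01 mul0r mul0r.
have [w0|w0] := eqVneq (w [set z]) 0.
  by rewrite /y /rounding_value -/(a _) -/(w _) w0 invr0 mulr0 mul0r.
by rewrite [1 - _](_ : _ = 0) ?mulr0 // /y /rounding_value divff ?subrr.
Qed.

End Rounding.

(** * The projection error *)

Lemma sum_sqnormB (R : realType) (I : finType) (m : nat) (W : {set I})
    (p : I -> 'rV[R]_m) :
  \sum_(u in W) \sum_(v in W) sqnorm (p u - p v) =
  2 * #|W|%:R * \sum_(u in W) sqnorm (p u - #|W|%:R^-1 *: \sum_(v in W) p v).
Proof.
have [->|W0] := eqVneq W set0; first by rewrite !big_set0 mulr0.
have N0 : #|W|%:R != 0 :> R by rewrite pnatr_eq0 cards_eq0.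
set N : R := #|W|%:R in N0 *; set s := \sum_(v in W) p v.
have sumB (c : 'rV[R]_m) : \sum_(u in W) sqnorm (p u - c) =
    \sum_(u in W) sqnorm (p u) - 2 * dot s c + N * sqnorm c.
  under eq_bigr do rewrite sqnormB.
  by rewrite big_split /= sumrB -mulr_sumr -dot_suml sumr_const -[_ *+ #|W|]mulr_natl.
rewrite sumB dotZr sqnormZ -/(sqnorm s).
rewrite (eq_bigr (fun u => \sum_(v in W) sqnorm (p v) - 2 * dot s (p u) + N * sqnorm (p u))).
  rewrite big_split /= sumrB -!mulr_sumr -dot_sumr sumr_const -[_ *+ #|W|]mulr_natl.
  by rewrite -/N -/s -/(sqnorm s); field.
by move=> u _; rewrite -sumB; apply: eq_bigr => v _; rewrite sqnormBC.
Qed.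

(** With a and c the sizes of the two sides, a c <= (a + c) min (a, c). *)
Lemma induced_expansion_cut (R : realType) (n : nat) (C : 'I_n -> 'I_n -> R)
    (W A : {set 'I_n}) (b : R) :
  regular_graph C -> 0 <= b -> induced_expansion_ge C W b -> A \subset W ->
  b * (#|A|%:R * #|W :\: A|%:R) <= #|W|%:R * edge_weight C A (W :\: A).
Proof.
move=> regC b0 expW AW.
have E0 := edge_weight_ge0 regC A (W :\: A).
have [->|A0] := eqVneq A set0.
  by rewrite cards0 mul0r mulr0 mulr_ge0 ?(edge_weight_ge0 regC).
have [->|AnW] := eqVneq A W.
  by rewrite setDv cards0 !mulr0 mulr_ge0 ?(edge_weight_ge0 regC).
have Ap : A \proper W by rewrite properEneq AnW.
have := expW A A0 Ap; rewrite /induced_expansion.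
have cardW : #|W| = (#|A| + #|W :\: A|)%N by rewrite -(cardsID A W) (setIidPr AW).
rewrite cardW addKn.
have a0 : (0 < #|A|)%N by rewrite card_gt0.
have c0 : (0 < #|W :\: A|)%N.
  by rewrite card_gt0 setD_eq0; case/andP: Ap.
set a := #|A| in a0 *; set c := #|W :\: A| in c0 *; set E := edge_weight _ _ _ in E0 *.
rewrite ler_pdivlMr ?ltr0n ?leq_min ?a0 ?c0 // => le_E.
apply: le_trans (_ : (a + c)%:R * (b * (minn a c)%:R) <= _); last exact: ler_wpM2l.
rewrite [X in _ <= X]mulrCA ler_wpM2l // -!natrM ler_nat.
by case: (leqP a c) => _; nia.
Qed.

Section CutError.
Variables (R : realType) (n m : nat) (x : vector_family R n m).
Implicit Types (S T : {set 'I_n}).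

Lemma sum_centered_vector : (0 < n)%N -> \sum_u centered_vector x u = 0.
Proof.
move=> n0; rewrite /centered_vector sumrB sumr_const card_ord -scaler_nat scalerA.
by rewrite mulfV ?scale1r ?subrr // pnatr_eq0 -lt0n.
Qed.

(* The averages over the two sides of the cut are collinear. *)
Lemma projection_error_cut S : (0 < n)%N ->
  exists2 W : 'M[R]_m, (\rank W <= 1)%N &
    projection_error x W <=
      \sum_(u in S) sqnorm (centered_vector x u
        - #|S|%:R^-1 *: \sum_(v in S) centered_vector x v) +
      \sum_(u in ~: S) sqnorm (centered_vector x u
        - #|~: S|%:R^-1 *: \sum_(v in ~: S) centered_vector x v).
Proof.
move=> n0; set b := \sum_(v in S) centered_vector x v.
exists <<b>>%MS; first by rewrite mxrank_gen rank_leq_row.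
have bW a : (a *: b <= <<b>>)%MS by rewrite genmxE scalemx_sub.
have -> : \sum_(v in ~: S) centered_vector x v = - b.
  have := sum_centered_vector n0; rewrite (bigID (mem S)) /= -/b.
  rewrite (eq_bigl (fun v => v \in ~: S)) => [/eqP|v]; last by rewrite inE.
  by rewrite addrC addr_eq0 => /eqP.
rewrite /projection_error (bigID (mem S)) /=.
rewrite [X in _ + X](eq_bigl (fun v => v \in ~: S)) => [|v]; last by rewrite inE.
apply: lerD; apply: ler_sum => u _; apply: sqnorm_perp_proj_le => //.
by rewrite scalerN -scaleNr.
Qed.

(** For r = 1 the column selection factor is 2 / (2 - rank), which is at most 2. *)
Lemma column_selection1 T : (1 < n)%N -> column_selection x 1 T ->
  exists2 z, T = [set z] & forall W : 'M[R]_m, (\rank W <= 1)%N ->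
    projection_error x (seed_span x T) <= 2 * projection_error x W.
Proof.
move=> n1 [cardT sel]; rewrite (minn_idPl (ltnW n1)) in cardT.
have /eqP/cards1P[z Tz] := cardT; exists z => // W rW.
have := sel W; rewrite cardT => /(_ rW).
have err0 : 0 <= projection_error x (seed_span x T).
  by apply: sumr_ge0 => u _; apply: sqnorm_ge0.
apply: le_trans; rewrite ler_peMl // ler1n subn_gt0 ltnS; exact: rW.
Qed.

Lemma sum_cluster_le t (C : 'I_n -> 'I_n -> R) (W : {set 'I_n}) (b L : R) :
  regular_graph C -> (2 <= t)%N -> lasserre_vectors t x ->
  0 <= b -> 1 / 4 <= L -> #|W|%:R <= sequences.expR L ->
  induced_expansion_ge C W b ->
  b * \sum_(u in W) sqnorm (centered_vector x u
        - #|W|%:R^-1 *: \sum_(v in W) centered_vector x v) <=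
  384 * Num.sqrt L * \sum_(u in W) \sum_(v in W)
    C u v * sqnorm (vertex_vector x u - vertex_vector x v).
Proof.
move=> regC t2 lass b0 L4 cardW expW; have [C0 CC _] := regC.
have [->|W0] := eqVneq W set0; first by rewrite !big_set0 !mulr0.
have N0 : 0 < #|W|%:R :> R by rewrite ltr0n card_gt0.
have tri u v z : u \in W -> v \in W -> z \in W ->
    sqnorm (vertex_vector x u - vertex_vector x v) <=
    sqnorm (vertex_vector x u - vertex_vector x z) +
    sqnorm (vertex_vector x z - vertex_vector x v).
  by move=> _ _ _; apply: (vertex_triangle t2 lass).
have := average_distance_le b0 L4 cardW C0 CC tri
  (fun A => induced_expansion_cut regC b0 expW).
(* Centering cancels in differences, and the factor 2 |W| between pairs and centroid turns 768 into
   384. *)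
rewrite (_ : \sum_(u in W) \sum_(v in W) sqnorm _ = 2 * #|W|%:R *
   \sum_(u in W) sqnorm (centered_vector x u
        - #|W|%:R^-1 *: \sum_(v in W) centered_vector x v)); last first.
  rewrite -sum_sqnormB; apply: eq_bigr => u _; apply: eq_bigr => v _.
  by rewrite /centered_vector opprB addrA subrK.
set V := \sum_(u in W) sqnorm _; set Q := \sum_(u in W) \sum_(v in W) _ => le1.
rewrite -(ler_pM2l N0); lra.
Qed.

End CutError.

(** * Constants and conclusion *)

Lemma half_le_ln2 (R : realType) : 1 / 2 <= ln 2 :> R.
Proof.
have : ln (1 + (- (1 / 2))) <= - (1 / 2) :> R by apply: le_ln1Dx; lra.
have -> : 1 + (- (1 / 2)) = 2^-1 :> R by lra.
by rewrite lnV ?posrE //; lra.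
Qed.

(** S is the smaller side, and n / (n - |S|) <= 2. *)
Lemma sparsity_le_expansion (R : realType) (n : nat) (C : 'I_n -> 'I_n -> R)
    (S : {set 'I_n}) :
  regular_graph C -> S != set0 -> 2 * #|S|%:R <= n%:R :> R ->
  sparsity C S <= 2 * expansion C S.
Proof.
move=> regC S0 Sn.
have E0 := edge_weight_ge0 regC S (~: S).
have a0 : 0 < #|S|%:R :> R by rewrite ltr0n card_gt0.
rewrite /expansion /induced_expansion setTD cardsT card_ord (minn_idPl _); last first.
  by rewrite -(ler_nat R) natr_subn_card; lra.
rewrite /sparsity natr_subn_card mulrA.
set E := edge_weight _ _ _ in E0 *; set a : R := #|S|%:R in a0 Sn *.
rewrite ler_pdivrMr ?mulr_gt0 //; last by lra.
have -> : 2 * E / a * (a * (n%:R - a)) = 2 * E * (n%:R - a) by field; rewrite gt_eqF.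
nra.
Qed.

(** The constant is 2 * 384 * 2: column selection against the line through the averages of both
    sides, the bound on each side, and the ordered pairs in the cost, which the optimality of x
    compares with S. *)
Lemma projection_error_le (R : realType) (n t m k : nat) (C : 'I_n -> 'I_n -> R)
    (x : vector_family R n m) (S T : {set 'I_n}) (b L : R) :
  regular_graph C -> (2 <= t)%N -> lasserre_optimal t C k x -> (1 < n)%N ->
  is_cut S -> 0 <= b -> 1 / 4 <= L -> n%:R <= sequences.expR L ->
  induced_expansion_ge C S b -> induced_expansion_ge C (~: S) b ->
  column_selection x 1 T ->
  n%:R * (b * projection_error x (seed_span x T)) <=
    1536 * Num.sqrt L * (k%:R * (n%:R - k%:R)) * sparsity C S.
Proof.
move=> regC t2 opt n1 cutS b0 L4 nL expS expSc sel; have [C0 CC _] := regC.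
have [feas _] := opt; have [_ _ lass _] := feas.
have n0 : 0 < n%:R :> R by rewrite ltr0n ltnW.
have [z Tz errT] := column_selection1 n1 sel.
have [W rW errW] := projection_error_cut x S (ltnW n1).
have card_le A : #|A : {set 'I_n}|%:R <= sequences.expR L.
  by apply: le_trans nL; rewrite ler_nat; have := max_card (mem A); rewrite card_ord.
pose d u v : R := C u v * sqnorm (vertex_vector x u - vertex_vector x v).
pose V (A : {set 'I_n}) : R := \sum_(u in A) sqnorm (centered_vector x u
  - #|A|%:R^-1 *: \sum_(v in A) centered_vector x v).
have hV A : induced_expansion_ge C A b ->
    b * V A <= 384 * Num.sqrt L * \sum_(u in A) \sum_(v in A) d u v.
  exact: (sum_cluster_le regC t2 lass b0 L4 (card_le A)).
have := le_trans (errT W rW) (ler_wpM2l (ler0n R 2) errW).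
set err : R := projection_error _ _; rewrite -/(V S) -/(V (~: S)) => errV.
have d0 u v : 0 <= d u v by rewrite mulr_ge0 ?sqnorm_ge0.
have sub (A : {set 'I_n}) : \sum_(u in A) \sum_(v in A) d u v <= \sum_(u in A) \sum_v d u v.
  apply: ler_sum => u _; rewrite [X in _ <= X](bigID (mem A)) /= lerDl.
  by apply: sumr_ge0.
have Qle : \sum_(u in S) \sum_(v in S) d u v + \sum_(u in ~: S) \sum_(v in ~: S) d u v
    <= \sum_u \sum_v d u v.
  rewrite [X in _ <= X](bigID (mem S)) /=; apply: lerD; first exact: sub.
  by rewrite [X in _ <= X](eq_bigl (fun u => u \in ~: S)) => [|u]; rewrite ?sub // inE.
have kn : k%:R * (n%:R - k%:R) >= 0 :> R.
  have [_ kn _ _] := feas; rewrite mulr_ge0 // subr_ge0 ler_nat.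
  by rewrite (leq_trans _ kn) // -addnn leq_addr.
have Qobj : n%:R * \sum_u \sum_v d u v <= 2 * (k%:R * (n%:R - k%:R)) * sparsity C S.
  rewrite (lasserre_costE z regC feas).
  rewrite (_ : n%:R * _ = 2 * (k%:R * (n%:R - k%:R)) * lasserre_objective C k x).
    apply: ler_wpM2l; first by rewrite mulr_ge0.
    exact: (lasserre_objective_le_sparsity regC opt).
  by field; rewrite gt_eqF.
have s0 := sqrtr_ge0 L.
apply: le_trans (_ : n%:R * (768 * Num.sqrt L * \sum_u \sum_v d u v) <= _).
  rewrite ler_pM2l //.
  have := ler_wpM2l b0 errV; have := ler_wpM2l s0 Qle.
  have := hV S expS; have := hV (~: S) expSc; lra.
by have := ler_wpM2l s0 Qobj; lra.
Qed.

Theorem theoremC1 (R : realType) :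
  exists (c K : R) (r : R -> nat),
    0 < c /\
    (forall rho : R, 0 < rho -> rho <= 1 / 2 -> (r rho)%:R <= K / rho) /\
    forall (eps : R) (n : nat) (C : 'I_n -> 'I_n -> R) (S : {set 'I_n})
           (rho : R),
      0 < eps -> eps < 1 ->
      regular_graph C ->
      S != finset.set0 -> #|S|%:R = rho * n%:R -> rho <= 1 / 2 ->
      let beta := c / eps `^ (3 / 2) * expansion C S *
                  Num.sqrt (ln n%:R * ln (1 / (rho * eps))) in
      induced_expansion_ge C S beta ->
      induced_expansion_ge C (~: S) beta ->
      forall (m k : nat) (x : vector_family R n m),
        lasserre_optimal (r rho + 3) C k x ->
        forall T : {set 'I_n},
          column_selection x (r rho) T ->
          2 / 3 <= success_probability x C eps T.
Proof.
(* One seed satisfies 1 <= 1 / rho. Here 192^2 = 2 * 6 * 3072: 2 for the square root of the second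
   logarithm, at least 1/2; 6 from [success_probability_ge]; 3072 = 2 * 1536 from
   [projection_error_le] and sparsity at most twice the expansion. *)
exists (192 ^+ 2), 1, (fun=> 1%N); split; first exact: exprn_gt0.
split=> [rho rho0 rho_le|].
  by rewrite ler_pdivlMr //; lra.
move=> eps n C S rho eps0 eps1 regC S0 cardS rho_le beta expS expSc m k x opt T sel.
have a0 : 0 < #|S|%:R :> R by rewrite ltr0n card_gt0.
have n0 : 0 < n%:R :> R.
  rewrite ltr0n lt0n; apply: contraTneq a0 => n0.
  by rewrite cardS n0 mulr0 ltxx.
have rho0 : 0 < rho by rewrite cardS pmulr_lgt0 in a0.
have Sn : 2 * #|S|%:R <= n%:R :> R by rewrite cardS; nra.
have n1 : (1 < n)%N.
  have : (0 < #|S|)%N by rewrite card_gt0.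
  by move: Sn; rewrite -natrM ler_nat; lia.
have cutS : is_cut S.
  split=> //; apply/eqP => ST; move: Sn a0; rewrite ST cardsT card_ord; lra.
have [feas _] := opt.
have [z Tz _] := column_selection1 n1 sel.
have opt_cut A : is_cut A -> lasserre_objective C k x <= sparsity C A.
  exact: (lasserre_objective_le_sparsity regC opt).
have phi_ge0 : 0 <= sparsest C by apply: (sparsest_ge cutS) => A _; apply: sparsity_ge0.
have [phi0|phi_n0] := eqVneq (sparsest C) 0.
  by rewrite Tz (success_probability_degenerate z regC _ feas opt_cut) //; lra.
have phi_gt0 : 0 < sparsest C by rewrite lt_def phi_n0.
have le_exp := sparsity_le_expansion regC S0 Sn.
have exp_gt0 : 0 < expansion C S.
  by have := lt_le_trans phi_gt0 (sparsest_le regC cutS); lra.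
have ln2 := half_le_ln2 R.
have L4 : 1 / 4 <= ln n%:R :> R.
  have : ln 2 <= ln n%:R :> R by rewrite ler_ln ?posrE // ler_nat.
  lra.
have l4 : 1 / 4 <= ln (1 / (rho * eps)).
  have re0 : 0 < rho * eps by rewrite mulr_gt0.
  have : ln 2 <= ln (1 / (rho * eps)).
    by rewrite ler_ln ?posrE ?divr_gt0 // ler_pdivlMr //; nra.
  lra.
have nL : n%:R <= sequences.expR (ln n%:R) :> R by rewrite lnK ?posrE.
have pow0 : 0 < eps `^ (3 / 2) by rewrite powR_gt0.
have pow_le : eps `^ (3 / 2) <= eps.
  have e01 : 0 < eps <= 1 by rewrite eps0 ltW.
  have := ger_powR e01 (_ : 1 <= 3 / 2); rewrite powRr1 ?(ltW eps0) //; apply; lra.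
have s0 : 0 < Num.sqrt (ln n%:R) :> R by rewrite sqrtr_gt0; lra.
(* This follows from eps^(3/2) <= eps and from ln (1 / (rho eps)) >= 1/4. *)
have beta_ge : 96 * 192 / eps * expansion C S * Num.sqrt (ln n%:R) <= beta.
  rewrite /beta sqrtrM; last by lra.
  have := half_le_sqrt l4; set sl := Num.sqrt (ln (1 / _)) => sl2.
  apply: le_trans (_ : 192 ^+ 2 / eps * expansion C S * (Num.sqrt (ln n%:R) * (1 / 2)) <= _).
    by rewrite le_eqVlt; apply/orP; left; apply/eqP; field; rewrite gt_eqF.
  have pe : 0 < 192 ^+ 2 / eps by rewrite divr_gt0 // exprn_gt0.
  apply: ler_pM.
  - by apply: mulr_ge0; apply: ltW.
  - by apply: mulr_ge0; [apply: ltW|lra].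
  - by rewrite ler_pM2r // ler_pM2l ?exprn_gt0 // lef_pV2 ?posrE.
  - by rewrite ler_pM2l.
have b0 : 0 <= beta.
  apply: le_trans beta_ge; apply: mulr_ge0 (ltW s0); apply: mulr_ge0 (ltW exp_gt0).
  by apply: divr_ge0 (ltW eps0); apply: mulr_ge0.
have := projection_error_le regC (isT : (2 <= 1 + 3)%N) opt n1 cutS b0 L4 nL expS expSc sel.
rewrite Tz; set err := projection_error _ _ => le_err.
apply: (success_probability_ge regC _ feas opt_cut) => //; rewrite -/err.
set K := k%:R * _ in le_err *.
have err0 : 0 <= err by apply: sumr_ge0 => u _; apply: sqnorm_ge0.
have K0 : 0 <= K.
  have [_ kn _ _] := feas; rewrite mulr_ge0 // subr_ge0 ler_nat.
  by rewrite (leq_trans _ kn) // -addnn leq_addr.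
have pos : 0 < 3072 * Num.sqrt (ln n%:R) * expansion C S.
  by apply: mulr_gt0 exp_gt0; apply: mulr_gt0 s0; lra.
(* After this scaling the goal is eps times [le2], since 96 * 192 = 6 * 3072. *)
rewrite -(ler_pM2r pos).
have nerr0 : 0 <= n%:R * err by rewrite mulr_ge0 // ltW.
have le1 := ler_wpM2r nerr0 beta_ge.
have le2 : 96 * 192 / eps * expansion C S * Num.sqrt (ln n%:R) * (n%:R * err) <=
    3072 * Num.sqrt (ln n%:R) * K * expansion C S.
  apply: le_trans le1 _; rewrite mulrCA; apply: le_trans le_err _.
  have := ler_wpM2l (mulr_ge0 (ltW s0) K0) le_exp; lra.
have := ler_wpM2l (ltW eps0) le2.
rewrite (_ : eps * (96 * 192 / eps * expansion C S * Num.sqrt (ln n%:R) * (n%:R * err)) =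
  6 * n%:R * err * (3072 * Num.sqrt (ln n%:R) * expansion C S)); last first.
  by field; rewrite gt_eqF.
lra.
Qed.
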